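(* Let $k$ be an algebraically closed field and let $A$ be a basic connected finite dimensional triangular $k$-algebra which admits a strongly simply connected Galois covering for a given presentation $kQ_A/I_A$ of $A$, i.e. there is a Galois covering of bound quivers $F:(\widetilde Q_A,\widetilde I_A)\to(Q_A,I_A)$ with $\widetilde A\cong k\widetilde Q_A/\widetilde I_A$ strongly simply connected. Then the fundamental group $\pi_1(Q_A,I_A)$ is free.
   Context: **Presentations.** $k$ is an algebraically closed field. A $k$-category is a category whose morphism sets are $k$-vector spaces with $k$-bilinear composition. It is locally bounded if all endomorphism algebras of objects are local, distinct objects are non-isomorphic, and for each object $x$ both $\sum_y\dim_k A(x,y)$ and $\sum_y\dim_k A(y,x)$ are finite. A basic finite dimensional algebra is viewed as a locally bounded category with finitely many objects. A presentation of a locally bounded category $A$ is an isomorphism $A\cong kQ_A/I$ where $Q_A$ is a locally finite quiver (the quiver of $A$) and $I$ is an admissible ideal of the path category $kQ_A$; $(Q_A,I)$ is called a bound quiver. $A$ is triangular if $Q_A$ has no oriented cycles. **Walks and homotopy.** Paths are composed from left to right. A walk is a trivial path $\varepsilon_a$ or a composable sequence $c_1\cdots c_r$ where each $c_i$ is an arrow or the formal inverse of an arrow. Let $(Q,I)$ be a connected locally finite bound quiver. A minimal relation is an element $\sum_{i=1}^n\lambda_ip_i\in I(a,b)$, with $\lambda_i\in k$ and $p_i$ paths from $a$ to $b$ of length at least two, such that $n\ge 2$ and $\sum_{j\in J}\lambda_jp_j\notin I(a,b)$ for every nonempty proper subset $J\subset\{1,\dots,n\}$. The homotopy relation $\sim$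 is the smallest equivalence relation on walks such that: (a) $\alpha\alpha^{-1}\sim\varepsilon_a$ and $\alpha^{-1}\alpha\sim\varepsilon_b$ for every arrow $\alpha:a\to b$; (b) $p_i\sim p_j$ for all $i,j$ whenever $\sum_i\lambda_ip_i$ is a minimal relation; (c) $u\sim v$ implies $w_1uw_2\sim w_1vw_2$ for all walks $w_1,w_2$ for which these compositions make sense. The fundamental group $\pi_1(Q,I)$ is the group of homotopy classes of closed walks at a fixed vertex, under concatenation (it does not depend on the vertex). **Strongly simply connected.** A full subcategory $C$ of a locally bounded category $R$ is convex if every path in the quiver of $R$ with both end vertices in $C$ has all its vertices in $C$. A triangular locally bounded $k$-category $R\cong kQ/I$ is simply connected if for every finite convex subcategory $C$ of $R$ and any presentation $C\cong kQ'/I'$ the fundamental group of $(Q',I')$ is trivial. A triangular locally bounded $k$-category $R\cong kQ/I$ is strongly simply connected if (1) for any two vertices $x,y$ of $Q$ there are only finitely many paths in $Q$ from $x$ to $y$; and (2) every finite convex subcategory $C$ of $R$ is simply connected. **Galois coverings.** Let $A=kQ/I$ and $A'=kQ'/I'$. Let $F:A'\to A$ be a surjective map induced from a surjective quiver map $F_1:Q'\to Q$ with $kF_1(I')\subset I$. $F$ (also written $F:(Q',I')\to(Q,I)$) is a Galois covering defined by the action of a group $G$ of automorphisms of the bound quiver $(Q',I')$ if: (1) $Fg=F$ for any $g\in G$; (2) $F_1^{-1}(x)=Gx'$ and $F_1^{-1}(\alpha)=G\alpha'$ for vertices $x$ in $Q$ and $x'$ in $Q'$ with $F_1x'=x$ and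 arrows $\alpha$ in $Q$ and $\alpha'$ in $Q'$ with $F_1\alpha'=\alpha$; (3) $G$ acts freely on $A'$, that is, if $g\in G$ fixes a vertex of $Q'$ then $g=1$.
   Formalization: The definition of Galois covering is completed by requiring that relations in I lift to relations in I' (so that A is the quotient of A' by G); with only kF_1(I') ⊂ I one could take I' = 0 on the universal cover of the quiver, and the claim fails. *)

(* Defs.v *)
From HB Require Import structures.
From mathcomp Require Import all_boot all_order all_algebra finmap boolp.
From mathcomp Require Import monalg.

Set Implicit Arguments.
Unset Strict Implicit.
Unset Printing Implicit Defensive.

Import GRing.Theory.
Local Open Scope ring_scope.
Local Open Scope quotient_scope.

Section ModuleQuotient.
Context (k : pzRingType) (V : lmodType k).

Section Submodule.
Variable S : submodClosed V.

(* [submodClosed] is declared over semirings, so closure under opposites has to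
   be supplied before the quotient [Z]-module of ring_quotient is available. *)
Definition submod_pred : {pred V} := fun v : V => v \in S.

Lemma submod_pred_zmod_closed : zmod_closed submod_pred.
Proof.
split=> [|u v Su Sv]; rewrite /submod_pred unfold_in ?rpred0 //.
by rewrite -scaleN1r rpredD ?rpredZ.
Qed.

HB.instance Definition _ :=
  GRing.isZmodClosed.Build V submod_pred submod_pred_zmod_closed.

Definition submod_zmod : zmodClosed V := submod_pred.

Definition mquot : Type := Quotient.quot submod_zmod.

HB.instance Definition _ := Choice.on mquot.
HB.instance Definition _ := GRing.Zmodule.on mquot.

Definition mclass (v : V) : mquot := \pi_(Quotient.quot submod_zmod) v.
Definition mrepr (q : mquot) : V := repr (q : Quotient.quot submod_zmod).

Lemma mreprK : cancel mrepr mclass. Proof. by move=> q; apply: reprK. Qed.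

Lemma mclassP u v : (mclass u = mclass v) <-> (u - v \in S).
Proof.
rewrite -[u - v \in S]/(u - v \in submod_pred) Quotient.idealrBE.
by split=> [/eqP|/eqP].
Qed.

Lemma mclass_is_zmod_morphism : zmod_morphism mclass.
Proof. by move=> u v; rewrite /mclass raddfB. Qed.

HB.instance Definition _ :=
  GRing.isZmodMorphism.Build V mquot mclass mclass_is_zmod_morphism.

Definition mscale (c : k) (q : mquot) : mquot := mclass (c *: mrepr q).

Lemma mscale_class c v : mscale c (mclass v) = mclass (c *: v).
Proof.
by apply/mclassP; rewrite -scalerBr rpredZ //; apply/mclassP; rewrite mreprK.
Qed.

Lemma mscaleA c d q : mscale c (mscale d q) = mscale (c * d) q.
Proof. by rewrite -[q]mreprK !mscale_class scalerA. Qed.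

Lemma mscale1 : left_id 1 mscale.
Proof. by move=> q; rewrite -[q]mreprK mscale_class scale1r. Qed.

Lemma mscaleDr : right_distributive mscale +%R.
Proof.
move=> c q r; rewrite -[q]mreprK -[r]mreprK -raddfD !mscale_class.
by rewrite scalerDr raddfD.
Qed.

Lemma mscaleDl q : {morph mscale^~ q : c d / c + d}.
Proof. by move=> c d; rewrite -[q]mreprK !mscale_class scalerDl raddfD. Qed.

HB.instance Definition _ := GRing.Zmodule_isLmodule.Build k mquot
  mscaleA mscale1 mscaleDr mscaleDl.

Lemma mclass_is_scalable : scalable mclass.
Proof. by move=> c v; rewrite -mscale_class. Qed.

HB.instance Definition _ :=
  GRing.isScalable.Build k V mquot *:%R mclass mclass_is_scalable.

End Submodule.
End ModuleQuotient.

Section LinearExtension.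
Context (k : nzRingType) (K : choiceType) (V : lmodType k) (h : K -> V).

Definition mext (g : {malg k[K]}) : V := \sum_(p <- msupp g) g@_p *: h p.

Lemma mextEw (d : {fset K}) g : (msupp g `<=` d)%fset ->
  mext g = \sum_(p <- d) g@_p *: h p.
Proof.
move=> le; rewrite [LHS](big_fset_incl _ le) => //= p pd /mcoeff_outdom ->.
by rewrite scale0r.
Qed.

Lemma mext_is_linear : linear mext.
Proof.
move=> c f g; pose d := (msupp f `|` msupp g)%fset.
have fd : (msupp f `<=` d)%fset by apply: fsubsetUl.
have gd : (msupp g `<=` d)%fset by apply: fsubsetUr.
have fgd : (msupp (c *: f + g) `<=` d)%fset.
  apply: (fsubset_trans (msuppD_le _ _)); apply: fsetSU.
  exact: msuppZ_le.
rewrite (mextEw fd) (mextEw gd) (mextEw fgd) scaler_sumr -big_split /=.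
by apply: eq_bigr => p _; rewrite mcoeffD mcoeffZ scalerDl scalerA.
Qed.

HB.instance Definition _ :=
  GRing.isLinear.Build k {malg k[K]} V *:%R mext mext_is_linear.

Lemma mextU p : mext << p >> = h p.
Proof. by rewrite (mextEw msuppU_le) big_seq_fset1 mcoeffUU scale1r. Qed.

End LinearExtension.

Lemma malg_lin_eq (k : nzRingType) (K : choiceType) (V : lmodType k)
    (u v : {linear {malg k[K]} -> V}) :
  (forall p, u << p >> = v << p >>) -> u =1 v.
Proof.
move=> uv g; rewrite [g]monalgE !linear_sum; apply: eq_bigr => p _.
suff -> : << g@_p *g p >> = g@_p *: << p >> :> {malg k[K]}.
  by rewrite !linearZ_LR uv.
apply/malgP => q; rewrite mcoeffZ !mcoeffU.
by case: eqP => _; rewrite ?mulr1n ?mulr0n ?mulr1 ?mulr0.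
Qed.

(* Composition is written from left to right: [kcomp f g] is [f] followed by
   [g]. *)
Record kcat (k : fieldType) := KCat {
  kobj :> choiceType;
  khom : kobj -> kobj -> lmodType k;
  kid : forall x, khom x x;
  kcomp : forall x y z, khom x y -> khom y z -> khom x z;
  kcomp_linearl : forall x y z (g : khom y z),
    linear ((fun f => kcomp f g) : khom x y -> khom x z);
  kcomp_linearr : forall x y z (f : khom x y),
    linear (kcomp f : khom y z -> khom x z);
  kcompA : forall x y z t (f : khom x y) (g : khom y z) (h : khom z t),
    kcomp f (kcomp g h) = kcomp (kcomp f g) h;
  kcomp1l : forall x y (f : khom x y), kcomp (kid x) f = f;
  kcomp1r : forall x y (f : khom x y), kcomp f (kid y) = f
}.

Arguments khom {k} _ _ _.
Arguments kid {k} _ _.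
Arguments kcomp {k _ x y z} _ _.

Record kiso (k : fieldType) (C D : kcat k) := KIso {
  kiso_obj :> C -> D;
  kiso_hom : forall x y, {linear khom C x y -> khom D (kiso_obj x) (kiso_obj y)};
  kiso_obj_bij : bijective kiso_obj;
  kiso_hom_bij : forall x y, bijective (kiso_hom x y);
  kiso_id : forall x, kiso_hom x x (kid C x) = kid D (kiso_obj x);
  kiso_comp : forall x y z (f : khom C x y) (g : khom C y z),
    kiso_hom x z (kcomp f g) = kcomp (kiso_hom x y f) (kiso_hom y z g)
}.

Definition full_subcat (k : fieldType) (C : kcat k) (S : {fset C}) : kcat k :=
  @KCat k (fset_sub_type S)
    (fun x y => khom C (val x) (val y))
    (fun x => kid C (val x))
    (fun x y z f g => kcomp f g)
    (fun x y z g => @kcomp_linearl k C _ _ _ g)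
    (fun x y z f => @kcomp_linearr k C _ _ _ f)
    (fun x y z t f g h => kcompA f g h)
    (fun x y f => kcomp1l f)
    (fun x y f => kcomp1r f).

Section CategoryProperties.
Context (k : fieldType) (C : kcat k).

Definition kinvertible (x y : C) (f : khom C x y) : Prop :=
  exists g : khom C y x, kcomp f g = kid C x /\ kcomp g f = kid C y.

Definition local_end (x : C) : Prop :=
  kid C x <> 0 /\
  forall f g : khom C x x, ~ kinvertible f -> ~ kinvertible g ->
    ~ kinvertible (f + g).

Definition finite_dim (V : lmodType k) : Prop :=
  exists (n : nat) (b : 'I_n -> V),
    forall v, exists c : 'I_n -> k, v = \sum_i c i *: b i.

Definition finite_total_dim (V : C -> lmodType k) : Prop :=
  (forall y, finite_dim (V y)) /\
  exists S : {fset C}, forall y (v : V y), v != 0 -> y \in S.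

Record locally_bounded : Prop := LocallyBounded {
  lb_local : forall x, local_end x;
  lb_basic : forall x y (f : khom C x y), kinvertible f -> x = y;
  lb_out : forall x, finite_total_dim (fun y => khom C x y);
  lb_in : forall x, finite_total_dim (fun y => khom C y x)
}.

Definition finitely_many_objects : Prop :=
  exists S : {fset C}, forall x : C, x \in S.

Definition connected_kcat : Prop :=
  inhabited C /\
  forall P : pred C, (exists x, P x) -> (exists y, ~~ P y) ->
    exists x y, [/\ P x, ~~ P y &
      (exists f : khom C x y, f != 0) \/ (exists f : khom C y x, f != 0)].

End CategoryProperties.

Record quiver := Quiver {
  vertex :> choiceType;
  arrow : choiceType;
  src : arrow -> vertex;
  tgt : arrow -> vertex
}.

Arguments src {q} _.
Arguments tgt {q} _.

Section Paths.
Variable Q : quiver.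

(* A path from [x] to [y] is the sequence of its arrows, read from left to
   right; the trivial path at [x] is the empty sequence from [x] to [x]. *)
Fixpoint is_path (x : Q) (p : seq (arrow Q)) (y : Q) : bool :=
  if p is a :: p' then (src a == x) && is_path (tgt a) p' y else x == y.

Definition qpath (x y : Q) : choiceType := {p : seq (arrow Q) | is_path x p y}.

Lemma is_path_cat x y z p q :
  is_path x p y -> is_path y q z -> is_path x (p ++ q) z.
Proof.
by elim: p x => [|a p IH] x /= => [/eqP->|/andP[-> /IH]] //; apply.
Qed.

Definition path_cat x y z (p : qpath x y) (q : qpath y z) : qpath x z :=
  exist _ (val p ++ val q) (is_path_cat (valP p) (valP q)).

Definition path_nil x : qpath x x := exist _ [::] (eqxx x).

Definition acyclic : Prop := forall (x : Q) p, is_path x p x -> p = [::].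

Definition finitely_many_paths : Prop :=
  forall x y : Q, exists s : seq (seq (arrow Q)),
    forall p, is_path x p y -> p \in s.

Definition locally_finite : Prop :=
  forall x : Q, exists s : seq (arrow Q),
    forall a, (src a == x) || (tgt a == x) -> a \in s.

(* [(a, true)] is the arrow [a] and [(a, false)] its formal inverse. *)
Definition letter : Type := (arrow Q * bool)%type.
Definition lsrc (l : letter) : Q := if l.2 then src l.1 else tgt l.1.
Definition ltgt (l : letter) : Q := if l.2 then tgt l.1 else src l.1.

Fixpoint is_walk (x : Q) (w : seq letter) (y : Q) : bool :=
  if w is l :: w' then (lsrc l == x) && is_walk (ltgt l) w' y else x == y.

Definition walk_of_path (p : seq (arrow Q)) : seq letter :=
  [seq (a, true) | a <- p].

Definition letter_inv (l : letter) : letter := (l.1, ~~ l.2).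
Definition walk_inv (w : seq letter) : seq letter := rev (map letter_inv w).

Lemma is_walk_cat x y z u v :
  is_walk x u y -> is_walk y v z -> is_walk x (u ++ v) z.
Proof.
by elim: u x => [|l u IH] x /= => [/eqP->|/andP[-> /IH]] //; apply.
Qed.

Lemma is_walk_inv x y w : is_walk x w y -> is_walk y (walk_inv w) x.
Proof.
elim: w x => [|l w IH] x /= => [/eqP->|]; first by rewrite /walk_inv /= eqxx.
case/andP=> /eqP <- /IH lw; rewrite /walk_inv /= rev_cons -cats1.
apply: (is_walk_cat lw) => /=; case: l {lw} => a [] /=.
  by rewrite /lsrc /ltgt /= !eqxx.
by rewrite /lsrc /ltgt /= !eqxx.
Qed.

End Paths.

Arguments walk_of_path {Q} _.
Arguments acyclic _ : clear implicits.

Record qmap (Q Q' : quiver) := QMap {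
  qmap_v :> Q -> Q';
  qmap_a : arrow Q -> arrow Q';
  qmap_src : forall a, src (qmap_a a) = qmap_v (src a);
  qmap_tgt : forall a, tgt (qmap_a a) = qmap_v (tgt a)
}.

Section PathMap.
Context (Q Q' : quiver) (F : qmap Q Q').

Lemma is_path_map x y p :
  is_path x p y -> is_path (F x) (map (qmap_a F) p) (F y).
Proof.
elim: p x => [|a p IH] x /= => [/eqP->|/andP[/eqP<- /IH]] //.
by rewrite qmap_src eqxx qmap_tgt.
Qed.

Definition path_map x y (p : qpath x y) : qpath (F x) (F y) :=
  exist _ (map (qmap_a F) (val p)) (is_path_map (valP p)).

End PathMap.

Section PathCategory.
Context (k : fieldType) (Q : quiver).

Definition kpath (x y : Q) : lmodType k := {malg k[qpath x y]}.

Definition kpath_comp x y z (f : kpath x y) (g : kpath y z) : kpath x z :=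
  mext (fun p => mext (fun q => << path_cat p q >> : kpath x z) g) f.

Lemma kpath_comp_linearl x y z (g : kpath y z) :
  linear ((fun f => kpath_comp f g) : kpath x y -> kpath x z).
Proof. by move=> c f f'; rewrite /kpath_comp linearP. Qed.

Lemma kpath_comp_linearr x y z (f : kpath x y) :
  linear (kpath_comp f : kpath y z -> kpath x z).
Proof.
move=> c g g'; rewrite /kpath_comp /mext scaler_sumr -big_split /=.
apply: eq_bigr => p _; rewrite -!/(mext _ _) linearP scalerDr !scalerA.
by rewrite [c * _]mulrC.
Qed.

Lemma kpath_compU x y z (p : qpath x y) (q : qpath y z) :
  kpath_comp << p >> << q >> = << path_cat p q >>.
Proof. by rewrite /kpath_comp !mextU. Qed.

End PathCategory.

Arguments kpath k {Q} _ _.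
Arguments kpath_comp {k Q x y z} _ _.

HB.instance Definition _ (k : fieldType) (Q : quiver) (x y z : Q)
    (f : kpath k x y) :=
  GRing.isLinear.Build k (kpath k y z) (kpath k x z) *:%R (kpath_comp f)
    (@kpath_comp_linearr k Q x y z f).

Definition kpath_compr (k : fieldType) (Q : quiver) (x y z : Q)
  (g : kpath k y z) (f : kpath k x y) : kpath k x z := kpath_comp f g.

HB.instance Definition _ (k : fieldType) (Q : quiver) (x y z : Q)
    (g : kpath k y z) :=
  GRing.isLinear.Build k (kpath k x y) (kpath k x z) *:%R (kpath_compr g)
    (@kpath_comp_linearl k Q x y z g).

Section PathCategoryLaws.
Context (k : fieldType) (Q : quiver).

Lemma kpath_compA (x y z t : Q) (f : kpath k x y) (g : kpath k y z)
    (h : kpath k z t) :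
  kpath_comp f (kpath_comp g h) = kpath_comp (kpath_comp f g) h.
Proof.
apply: (malg_lin_eq (u := kpath_compr (kpath_comp g h))
  (v := kpath_compr h \o kpath_compr g)) => p /=; rewrite /kpath_compr.
apply: (malg_lin_eq (u := kpath_comp << p >> \o kpath_compr h)
  (v := kpath_compr h \o kpath_comp << p >>)) => q /=; rewrite /kpath_compr.
apply: (malg_lin_eq (u := kpath_comp << p >> \o kpath_comp << q >>)
  (v := kpath_comp (kpath_comp << p >> << q >>))) => r /=.
rewrite !kpath_compU; congr (<< _ >>).
by apply: val_inj; rewrite /= catA.
Qed.

Lemma kpath_comp1l (x y : Q) (f : kpath k x y) :
  kpath_comp << path_nil x >> f = f.
Proof.
apply: (malg_lin_eq (u := kpath_comp << path_nil x >>) (v := idfun)) => p /=.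
by rewrite kpath_compU; congr (<< _ >>); apply: val_inj.
Qed.

Lemma kpath_comp1r (x y : Q) (f : kpath k x y) :
  kpath_comp f << path_nil y >> = f.
Proof.
apply: (malg_lin_eq (u := kpath_compr << path_nil y >>) (v := idfun)) => p /=.
rewrite /kpath_compr kpath_compU; congr (<< _ >>).
by apply: val_inj; rewrite /= cats0.
Qed.

End PathCategoryLaws.

(* For a locally finite quiver, an ideal is admissible when it is spanned by
   combinations of paths of length at least two and, for every vertex [x],
   contains all long enough paths starting or ending at [x]; for a finite
   quiver this is the usual (kQ^+)^m <= I <= (kQ^+)^2. *)
Record bound_quiver (k : fieldType) := BoundQuiver {
  bq_quiver :> quiver;
  bq_ideal : forall x y : bq_quiver, submodClosed (kpath k x y);
  bq_ideal_l : forall x y z (f : kpath k x y) (g : kpath k y z),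
    f \in bq_ideal x y -> kpath_comp f g \in bq_ideal x z;
  bq_ideal_r : forall x y z (f : kpath k x y) (g : kpath k y z),
    g \in bq_ideal y z -> kpath_comp f g \in bq_ideal x z;
  bq_locally_finite : locally_finite bq_quiver;
  bq_length2 : forall x y (f : kpath k x y), f \in bq_ideal x y ->
    forall p : qpath x y, p \in msupp f -> (2 <= size (val p))%N;
  bq_nilpotent : forall x, exists n, forall y z (p : qpath y z),
    (y == x) || (z == x) -> (n <= size (val p))%N -> << p >> \in bq_ideal y z
}.

Arguments bq_ideal {k} _ _ _.

Section BoundQuiverCategory.
Context (k : fieldType) (B : bound_quiver k).

Definition bqhom (x y : B) : lmodType k := mquot (bq_ideal B x y).

Definition bqpi (x y : B) (f : kpath k x y) : bqhom x y :=
  mclass (bq_ideal B x y) f.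

HB.instance Definition _ (x y : B) :=
  GRing.Linear.copy (@bqpi x y) (mclass (bq_ideal B x y)).

Definition bqcomp (x y z : B) (f : bqhom x y) (g : bqhom y z) : bqhom x z :=
  bqpi (kpath_comp (mrepr f) (mrepr g)).

Lemma bqcomp_pi (x y z : B) (f : kpath k x y) (g : kpath k y z) :
  bqcomp (bqpi f) (bqpi g) = bqpi (kpath_comp f g).
Proof.
have subD : forall (x y : B) (f : kpath k x y),
    mrepr (bqpi f) - f \in bq_ideal B x y.
  by move=> x' y' f'; apply/mclassP; rewrite mreprK.
apply/mclassP; set f' := mrepr _; set g' := mrepr _.
have -> : kpath_comp f' g' - kpath_comp f g =
          kpath_compr g' (f' - f) + kpath_comp f (g' - g).
  by rewrite !linearB /= /kpath_compr addrA subrK.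
by apply: rpredD; [apply: bq_ideal_l|apply: bq_ideal_r]; apply: subD.
Qed.

Lemma bqcomp_linearl (x y z : B) (g : bqhom y z) :
  linear ((fun f => bqcomp f g) : bqhom x y -> bqhom x z).
Proof.
move=> c f f'; rewrite -[g]mreprK -[f]mreprK -[f']mreprK -!/(bqpi _).
by rewrite -linearP !bqcomp_pi kpath_comp_linearl linearP.
Qed.

Lemma bqcomp_linearr (x y z : B) (f : bqhom x y) :
  linear (bqcomp f : bqhom y z -> bqhom x z).
Proof.
move=> c g g'; rewrite -[g]mreprK -[f]mreprK -[g']mreprK -!/(bqpi _).
by rewrite -linearP !bqcomp_pi kpath_comp_linearr linearP.
Qed.

Lemma bqcompA (x y z t : B) (f : bqhom x y) (g : bqhom y z) (h : bqhom z t) :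
  bqcomp f (bqcomp g h) = bqcomp (bqcomp f g) h.
Proof.
rewrite -[g]mreprK -[f]mreprK -[h]mreprK -!/(bqpi _).
by rewrite !bqcomp_pi kpath_compA.
Qed.

Lemma bqcomp1l (x y : B) (f : bqhom x y) :
  bqcomp (bqpi << path_nil x >>) f = f.
Proof. by rewrite -[f]mreprK -!/(bqpi _) bqcomp_pi kpath_comp1l. Qed.

Lemma bqcomp1r (x y : B) (f : bqhom x y) :
  bqcomp f (bqpi << path_nil y >>) = f.
Proof. by rewrite -[f]mreprK -!/(bqpi _) bqcomp_pi kpath_comp1r. Qed.

Definition bqcat : kcat k :=
  KCat bqcomp_linearl bqcomp_linearr bqcompA bqcomp1l bqcomp1r.

End BoundQuiverCategory.

Definition presentation (k : fieldType) (A : kcat k) (B : bound_quiver k) :=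
  kiso A (bqcat B).

Section Homotopy.
Context (k : fieldType) (B : bound_quiver k).

Definition minimal_relation (x y : B) (n : nat) (c : 'I_n -> k)
    (p : 'I_n -> qpath x y) : Prop :=
  [/\ (2 <= n)%N,
      forall i, (2 <= size (val (p i)))%N,
      \sum_i c i *: (<< p i >> : kpath k x y) \in bq_ideal B x y &
      forall J : {set 'I_n}, J != set0 -> J \proper setT ->
        \sum_(i in J) c i *: (<< p i >> : kpath k x y) \notin bq_ideal B x y].

(* [homotopic x y u v] relates walks [u], [v] from [x] to [y]. *)
Inductive homotopic : B -> B -> seq (letter B) -> seq (letter B) -> Prop :=
| homotopic_refl x y w : is_walk x w y -> homotopic x y w w
| homotopic_sym x y u v : homotopic x y u v -> homotopic x y v u
| homotopic_trans x y u v w :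
    homotopic x y u v -> homotopic x y v w -> homotopic x y u w
| homotopic_arrow_inv (a : arrow B) :
    homotopic (src a) (src a) [:: (a, true); (a, false)] [::]
| homotopic_inv_arrow (a : arrow B) :
    homotopic (tgt a) (tgt a) [:: (a, false); (a, true)] [::]
| homotopic_relation x y n (c : 'I_n -> k) (p : 'I_n -> qpath x y) i j :
    minimal_relation c p ->
    homotopic x y (walk_of_path (val (p i))) (walk_of_path (val (p j)))
| homotopic_cat x x' y' y w1 w2 u v :
    is_walk x w1 x' -> is_walk y' w2 y -> homotopic x' y' u v ->
    homotopic x y (w1 ++ u ++ w2) (w1 ++ v ++ w2).

Lemma homotopic_catl x y z w u v : is_walk x w y ->
  homotopic y z u v -> homotopic x z (w ++ u) (w ++ v).
Proof.
move=> xwy uv.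
by have := homotopic_cat xwy (eqxx z : is_walk z [::] z) uv; rewrite !cats0.
Qed.

Lemma homotopic_catr x y z w u v : is_walk y w z ->
  homotopic x y u v -> homotopic x z (u ++ w) (v ++ w).
Proof. by move=> ywz; apply: (homotopic_cat (eqxx x : is_walk x [::] x)). Qed.

Lemma homotopic_invr x y w : is_walk x w y -> homotopic x x (w ++ walk_inv w) [::].
Proof.
elim: w x => [|l w IH] x /=; first by move=> _; apply/homotopic_refl/eqxx.
case/andP=> /eqP lx lw; have {}IH := IH _ lw.
have xl : is_walk x [:: l] (ltgt l) by rewrite /= lx !eqxx.
have lx' : is_walk (ltgt l) [:: letter_inv l] x.
  by rewrite -lx /=; case: (l) => a []; rewrite /lsrc /ltgt /= !eqxx.
apply: (@homotopic_trans _ _ _ [:: l; letter_inv l]).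
  have := homotopic_cat xl lx' IH; rewrite /walk_inv /= rev_cons -cats1.
  by rewrite -catA.
rewrite -lx; case: (l) => a [].
  exact: homotopic_arrow_inv.
exact: homotopic_inv_arrow.
Qed.

Lemma walk_invK : involutive (@walk_inv B).
Proof.
move=> w; rewrite /walk_inv map_rev revK mapK // => -[a b].
by rewrite /letter_inv /= negbK.
Qed.

Lemma homotopic_invl x y w : is_walk x w y -> homotopic y y (walk_inv w ++ w) [::].
Proof. by move=> /is_walk_inv/homotopic_invr; rewrite walk_invK. Qed.

Lemma homotopic_walk x y u v :
  homotopic x y u v -> is_walk x u y /\ is_walk x v y.
Proof.
have path_walk x' y' (p : qpath x' y') : is_walk x' (walk_of_path (val p)) y'.
  case: p => p /=; elim: p x' => //= a p IH x' /andP[ax' /IH ->].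
  by rewrite andbT.
elim=> // {x y u v}.
- by move=> x y u v _ [].
- by move=> x y u v w _ [? _] _ [].
- by move=> a; rewrite /= /lsrc /ltgt /= !eqxx.
- by move=> a; rewrite /= /lsrc /ltgt /= !eqxx.
- move=> x x' y' y w1 w2 u v xw1 yw2 _ [xu xv].
  by split; apply: (is_walk_cat xw1); [exact: (is_walk_cat xu)|exact: (is_walk_cat xv)].
Qed.

Section FundamentalGroup.
Variable x : B.

Definition loop : choiceType := {w : seq (letter B) | is_walk x w x}.

Definition loop_eq (u v : loop) : bool := `[< homotopic x x (val u) (val v) >].

Lemma loop_eq_equiv : equiv_class_of loop_eq.
Proof.
split=> [u|u v|v u w].
- by apply/asboolP/homotopic_refl/(valP u).
- by apply/asboolP/asboolP; apply: homotopic_sym.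
- move=> /asboolP uv /asboolP vw; apply/asboolP.
  exact: homotopic_trans uv vw.
Qed.

Canonical loop_equiv := EquivRelPack loop_eq_equiv.

Definition pi1 : Type := {eq_quot loop_eq}.

HB.instance Definition _ := Choice.on pi1.

Definition pi1_class (w : loop) : pi1 := \pi_({eq_quot loop_eq}) w.
Definition pi1_repr (c : pi1) : loop := repr (c : {eq_quot loop_eq}).

Lemma pi1_reprK : cancel pi1_repr pi1_class.
Proof. by move=> c; apply: reprK. Qed.

Lemma pi1_classP u v :
  pi1_class u = pi1_class v <-> homotopic x x (val u) (val v).
Proof.
split=> [/eqmodP/asboolP //|uv].
by apply/eqmodP/asboolP.
Qed.

Definition loop_one : loop := exist _ [::] (eqxx x).
Definition loop_mul (u v : loop) : loop :=
  exist _ (val u ++ val v) (is_walk_cat (valP u) (valP v)).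
Definition loop_inv (u : loop) : loop :=
  exist _ (walk_inv (val u)) (is_walk_inv (valP u)).

Definition pi1_one : pi1 := pi1_class loop_one.
Definition pi1_mul (c d : pi1) : pi1 :=
  pi1_class (loop_mul (pi1_repr c) (pi1_repr d)).
Definition pi1_inv (c : pi1) : pi1 := pi1_class (loop_inv (pi1_repr c)).

Lemma pi1_repr_class u : homotopic x x (val (pi1_repr (pi1_class u))) (val u).
Proof. by apply/pi1_classP; rewrite pi1_reprK. Qed.

Lemma pi1_mulE u v :
  pi1_mul (pi1_class u) (pi1_class v) = pi1_class (loop_mul u v).
Proof.
apply/pi1_classP => /=.
apply: (@homotopic_trans _ _ _ (val u ++ val (pi1_repr (pi1_class v)))).
  exact: homotopic_catr (valP (pi1_repr _)) (pi1_repr_class u).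
exact: homotopic_catl (valP u) (pi1_repr_class v).
Qed.

Lemma pi1_mulA : associative pi1_mul.
Proof.
move=> a b c; rewrite -[a]pi1_reprK -[b]pi1_reprK -[c]pi1_reprK !pi1_mulE.
by congr pi1_class; apply: val_inj; rewrite /= catA.
Qed.

Lemma pi1_mul1 : left_id pi1_one pi1_mul.
Proof.
move=> a; rewrite -[a]pi1_reprK pi1_mulE.
by congr pi1_class; apply: val_inj.
Qed.

Lemma pi1_mulr1 : right_id pi1_one pi1_mul.
Proof.
move=> a; rewrite -[a]pi1_reprK pi1_mulE.
by congr pi1_class; apply: val_inj; rewrite /= cats0.
Qed.

Lemma pi1_mulV : left_inverse pi1_one pi1_inv pi1_mul.
Proof.
move=> a; rewrite -{2}[a]pi1_reprK pi1_mulE; apply/pi1_classP.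
exact: homotopic_invl (valP (pi1_repr a)).
Qed.

Lemma pi1_mulrV : right_inverse pi1_one pi1_inv pi1_mul.
Proof.
move=> a; rewrite -{1}[a]pi1_reprK pi1_mulE; apply/pi1_classP.
exact: homotopic_invr (valP (pi1_repr a)).
Qed.

HB.instance Definition _ := isGroup.Build pi1
  pi1_mulA pi1_mul1 pi1_mulr1 pi1_mulV pi1_mulrV.

End FundamentalGroup.

Definition trivial_pi1 : Prop := forall (x : B) (c : pi1 x), c = 1%g.

End Homotopy.

Section SimplyConnected.
Context (k : fieldType).

(* The quiver of [R] is read off the presentation [phi]. *)
Definition convex (R : kcat k) (B : bound_quiver k) (phi : presentation R B)
    (S : {fset R}) : Prop :=
  forall x y, x \in S -> y \in S ->
  forall p, is_path (phi x : B) p (phi y : B) ->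
  forall a, a \in p -> (tgt a : B) \in [fset (phi z : B) | z in S]%fset.

(* A finite convex subcategory need not be connected; its fundamental group is
   trivial when all its fundamental groups, one per base vertex, are. *)
Definition simply_connected (R : kcat k) (B : bound_quiver k)
    (phi : presentation R B) : Prop :=
  [/\ locally_bounded R, acyclic B &
      forall S : {fset R}, convex phi S ->
      forall (B' : bound_quiver k), presentation (full_subcat S) B' ->
        trivial_pi1 B'].

Definition strongly_simply_connected (R : kcat k) (B : bound_quiver k)
    (phi : presentation R B) : Prop :=
  [/\ locally_bounded R, acyclic B, finitely_many_paths B &
      forall S : {fset R}, convex phi S ->
      forall (B' : bound_quiver k) (psi : presentation (full_subcat S) B'),
        simply_connected psi].

End SimplyConnected.

Section GaloisCovering.
Context (k : fieldType).

Definition kpath_map (Q Q' : quiver) (F : qmap Q Q') (x y : Q)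
    (f : kpath k x y) : kpath k (F x) (F y) :=
  mext (fun p => << path_map F p >> : kpath k (F x) (F y)) f.

Definition bound_map (B B' : bound_quiver k) (F : qmap B B') : Prop :=
  forall x y (f : kpath k x y),
    f \in bq_ideal B x y -> kpath_map F f \in bq_ideal B' (F x) (F y).

(* [gc_lift] says that the relations of [B] are exactly those lifted from [B']:
   given [f] in [I (F x) (F y)], the combination of those of its paths that
   lift to paths from [x] to [y], lifted to [B'], is in [I' x y]. Together with
   [gc_bound] it means that [F] induces bijections from the direct sum of the
   (kQ'/I') (x, y'), for [y'] over [y], to (kQ/I) (F x, y), that is, that kQ/I
   is the quotient of kQ'/I' by [G]. Without it, one could take for [B'] the
   universal cover of the quiver with no relation. *)
Record galois_covering (B' B : bound_quiver k) (F : qmap B' B)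
    (G : groupType) (act : G -> qmap B' B') : Prop := GaloisCovering {
  gc_surj_v : forall x : B, exists x', F x' = x;
  gc_surj_a : forall a : arrow B, exists a', qmap_a F a' = a;
  gc_bound : bound_map F;
  gc_lift : forall (x y : B') (f' : kpath k x y) (f : kpath k (F x) (F y)),
    (forall p, f'@_p = f@_(path_map F p)) ->
    f \in bq_ideal B (F x) (F y) -> f' \in bq_ideal B' x y;
  gc_act_bound : forall g, bound_map (act g);
  gc_act1_v : forall x, act 1%g x = x;
  gc_act1_a : forall a, qmap_a (act 1%g) a = a;
  gc_actM_v : forall g h x, act (g * h)%g x = act g (act h x);
  gc_actM_a : forall g h a,
    qmap_a (act (g * h)%g) a = qmap_a (act g) (qmap_a (act h) a);
  gc_inv_v : forall g x, F (act g x) = F x;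
  gc_inv_a : forall g a, qmap_a F (qmap_a (act g) a) = qmap_a F a;
  gc_fibre_v : forall x y, F x = F y -> exists g, y = act g x;
  gc_fibre_a : forall a b, qmap_a F a = qmap_a F b ->
    exists g, b = qmap_a (act g) a;
  gc_free : forall g x, act g x = x -> g = 1%g
}.

End GaloisCovering.

Definition free_group (G : groupType) : Prop :=
  exists (X : Type) (i : X -> G),
    forall (H : groupType) (f : X -> H),
      exists phi : G -> H,
        [/\ {morph phi : a b / (a * b)%g}, forall t, phi (i t) = f t &
            forall psi : G -> H, {morph psi : a b / (a * b)%g} ->
              (forall t, psi (i t) = f t) -> psi =1 phi].

(* Main.v *)
(* Homomorphisms from the fundamental groupoid of (Q, I) to a group H are the
   labellings of the arrows by elements of H that take the same value on all the
   paths of each minimal relation. On the arrows leaving a vertex x, consider the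
   equivalence relation generated by "some minimal relation contains a path
   starting with a and a path starting with b", and let X consist of one arrow
   of each class, for every x. Then every map X -> H extends uniquely to a
   compatible labelling, that is, the groupoid is free on X. The labelling is
   built by induction on the height of x: a chain of relations from a to b
   forces the label of b to be that of a times the label of a walk among the
   proper successors of x. Two such walks lift to walks of the covering with the
   same end points, hence form a closed walk upstairs whose convex hull is finite
   and avoids the vertex over x; as that hull is simply connected, the two labels
   agree. The vertex group at a base point is then free on the arrows of X
   outside a spanning tree. *)

From HB Require Import structures.
From mathcomp Require Import all_boot all_algebra all_fingroup.
From mathcomp Require Import finmap boolp monalg.
Require Import Defs.

Set Implicit Arguments.
Unset Strict Implicit.
Unset Printing Implicit Defensive.

Import GRing.Theory.

(** * Walks and labellings of arrows by a group *)

Section WalkMap.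
Context (Q Q' : quiver) (F : qmap Q Q').

Definition walk_map (w : seq (letter Q)) : seq (letter Q') :=
  [seq (qmap_a F l.1, l.2) | l <- w].

Lemma walk_map_inv w : walk_map (walk_inv w) = walk_inv (walk_map w).
Proof. by rewrite /walk_map /walk_inv map_rev -!map_comp. Qed.

Lemma walk_map_of_path p :
  walk_map (walk_of_path p) = walk_of_path (map (qmap_a F) p).
Proof. by rewrite /walk_map /walk_of_path -!map_comp. Qed.

End WalkMap.

Section QuiverPaths.
Variable Q : quiver.
Implicit Types (x y z : Q) (p : seq (arrow Q)) (w : seq (letter Q)).

Lemma is_walk_of_path x p y : is_walk x (walk_of_path p) y = is_path x p y.
Proof. by elim: p x => //= a p IH x; rewrite IH. Qed.

Lemma is_path_split x p q y : is_path x (p ++ q) y ->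
  exists z, is_path x p z /\ is_path z q y.
Proof.
elim: p x => [|a p IH] x /= => [xqy|/andP[ax /IH[z [apz zqy]]]].
  by exists x; rewrite eqxx.
by exists z; rewrite ax apz.
Qed.

Lemma is_path_rcons x p a z y :
  is_path x p z -> src a = z -> tgt a = y -> is_path x (rcons p a) y.
Proof.
by move=> xpz az ay; rewrite -cats1;
  apply: (is_path_cat xpz); rewrite /= az ay !eqxx.
Qed.

End QuiverPaths.

Section Labelling.
Variables (Q : quiver) (H : groupType).
Implicit Types (f : arrow Q -> H) (w : seq (letter Q)).
Local Open Scope group_scope.

Definition letter_val f (l : letter Q) : H :=
  if l.2 then f l.1 else (f l.1)^-1.

Definition walk_val f w : H := \prod_(l <- w) letter_val f l.

Lemma walk_val_nil f : walk_val f [::] = 1.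
Proof. by rewrite /walk_val big_nil. Qed.

Lemma walk_val_cons f l w : walk_val f (l :: w) = letter_val f l * walk_val f w.
Proof. by rewrite /walk_val big_cons. Qed.

Lemma walk_val_cat f u w : walk_val f (u ++ w) = walk_val f u * walk_val f w.
Proof. by rewrite /walk_val big_cat. Qed.

Lemma walk_val_inv f w : walk_val f (walk_inv w) = (walk_val f w)^-1.
Proof.
elim: w => [|[a b] w IH]; first by rewrite /walk_inv /= walk_val_nil invg1.
rewrite /walk_inv /= rev_cons -cats1 walk_val_cat IH !walk_val_cons.
by rewrite walk_val_nil mulg1 invgM /letter_val; case: b => //=; rewrite invgK.
Qed.

Lemma eq_walk_val f g w :
  (forall l, l \in w -> f l.1 = g l.1) -> walk_val f w = walk_val g w.
Proof.
elim: w => [|l w IH] fg; first by rewrite !walk_val_nil.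
rewrite !walk_val_cons IH => [|m mw]; last by rewrite fg ?inE ?mw ?orbT.
by rewrite /letter_val fg ?mem_head.
Qed.

Lemma walk_val_potential f (h : Q -> H) x w y :
  (forall l, l \in w -> f l.1 = (h (src l.1))^-1 * h (tgt l.1)) ->
  is_walk x w y -> walk_val f w = (h x)^-1 * h y.
Proof.
elim: w x => [|[a b] w IH] x fh /= => [/eqP->|/andP[/eqP<- aw]].
  by rewrite walk_val_nil mulVg.
rewrite walk_val_cons (IH _ _ aw) => [|l lw]; last by rewrite fh ?inE ?lw ?orbT.
rewrite /letter_val fh ?mem_head // /lsrc /ltgt /=.
by case: b {aw fh} => /=; rewrite ?invgM ?invgK !mulgA mulgK.
Qed.

End Labelling.

Lemma walk_val_map (Q Q' : quiver) (F : qmap Q Q') (H : groupType)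
    (f : arrow Q' -> H) w :
  walk_val f (walk_map F w) = walk_val (f \o qmap_a F) w.
Proof. by rewrite /walk_val /walk_map big_map. Qed.

(** * Labellings that respect the minimal relations *)

Section Compatible.
Context (k : fieldType) (B : bound_quiver k) (H : groupType).
Implicit Types (S : B -> Prop) (f : arrow B -> H).
Local Open Scope group_scope.

(** Only the starting vertex of a relation is tested: the intended [S] are closed under successors,
    so all arrows of such a relation start in [S]. *)
Definition compatible_on S f : Prop :=
  forall (x y : B) n (c : 'I_n -> k) (p : 'I_n -> qpath x y),
    S x -> minimal_relation c p -> forall i j,
    walk_val f (walk_of_path (val (p i))) =
    walk_val f (walk_of_path (val (p j))).

Definition compatible f := compatible_on (fun=> True) f.

(** Each generating move of homotopy preserves the value, so a compatible labelling is a
    homomorphism from the fundamental groupoid to [H]. *)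
Lemma walk_val_homotopic f (x y : B) u v :
  compatible f -> homotopic x y u v -> walk_val f u = walk_val f v.
Proof.
move=> cf; elim=> // {x y u v}.
- by move=> x y u v w _ -> _.
- by move=> a; rewrite !walk_val_cons walk_val_nil /letter_val /= mulg1 mulgV.
- by move=> a; rewrite !walk_val_cons walk_val_nil /letter_val /= mulg1 mulVg.
- by move=> x y n c p i j mr; apply: cf mr _ _.
- by move=> x x' y' y w1 w2 u v _ _ _ uv; rewrite !walk_val_cat uv.
Qed.

(** The product along a path telescopes, so it depends only on the end points. *)
Lemma compatible_potential (h : B -> H) :
  compatible (fun a => (h (src a))^-1 * h (tgt a)).
Proof.
move=> x y n c p _ _ i j.
have E (q : qpath x y) :
    walk_val (fun a => (h (src a))^-1 * h (tgt a)) (walk_of_path (val q)) =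
    (h x)^-1 * h y.
  by apply: walk_val_potential; rewrite ?is_walk_of_path ?(valP q).
by rewrite !E.
Qed.

End Compatible.


(** * Full convex bound subquivers *)

Lemma preim_submod_closed (k : pzRingType) (V W : lmodType k)
    (h : {linear V -> W}) (S : submodClosed W) :
  submod_closed ((fun v => h v \in S) : {pred V}).
Proof.
have E v : (v \in ((fun v => h v \in S) : {pred V})) = (h v \in S) by [].
split=> [|c u v]; rewrite !E; first by rewrite linear0 rpred0.
by rewrite linearP => uS vS; rewrite rpredD ?rpredZ.
Qed.

Section PathMapLinear.
Context (k : fieldType) (Q Q' : quiver) (F : qmap Q Q').
Local Open Scope ring_scope.

HB.instance Definition _ (x y : Q) :=
  GRing.Linear.copy (@kpath_map k Q Q' F x y)
    (mext (fun p : qpath x y => << path_map F p >> : kpath k (F x) (F y))).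

Lemma kpath_mapU (x y : Q) (p : qpath x y) :
  kpath_map F (<< p >> : kpath k x y) = << path_map F p >>.
Proof. exact: mextU. Qed.

Lemma kpath_map_sum (x y : Q) (I : finType) (J : pred I) (c : I -> k)
    (p : I -> qpath x y) :
  kpath_map F (\sum_(i | J i) c i *: (<< p i >> : kpath k x y)) =
  \sum_(i | J i) c i *: (<< path_map F (p i) >> : kpath k (F x) (F y)).
Proof.
by rewrite linear_sum; apply: eq_bigr => i _; rewrite linearZ_LR /= kpath_mapU.
Qed.

Lemma kpath_map_comp (x y z : Q) (f : kpath k x y) (g : kpath k y z) :
  kpath_map F (kpath_comp f g) = kpath_comp (kpath_map F f) (kpath_map F g).
Proof.
apply: (malg_lin_eq (u := @kpath_map k _ _ F x z \o kpath_compr g)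
  (v := kpath_compr (kpath_map F g) \o @kpath_map k _ _ F x y)) => p /=.
rewrite /kpath_compr.
apply: (malg_lin_eq (u := @kpath_map k _ _ F x z \o kpath_comp << p >>)
  (v := kpath_comp (kpath_map F << p >>) \o @kpath_map k _ _ F y z)) => q /=.
rewrite kpath_compU !kpath_mapU kpath_compU; congr (<< _ >>).
by apply: val_inj; rewrite /= map_cat.
Qed.

Lemma mcoeff_kpath_map (x y : Q) (f : kpath k x y) (p : qpath x y) :
  injective (@path_map _ _ F x y) -> (kpath_map F f)@_(path_map F p) = f@_p.
Proof.
move=> injF; rewrite /kpath_map /mext raddf_sum /=.
have E q :
    (f@_q *: (<< path_map F q >> : kpath k (F x) (F y)))@_(path_map F p) =
    f@_q * (q == p)%:R.
  by rewrite mcoeffZ mcoeffU (inj_eq injF).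
under eq_bigr do rewrite E.
case: (msuppP f p) => [pf|pf].
  rewrite (big_fsetD1 p) //= eqxx mulr1 big_seq big1 ?addr0 // => q.
  by rewrite !inE => /andP[/negPf-> _]; rewrite mulr0.
rewrite big_seq big1 // => q qf.
by case: eqP pf => [<-|]; rewrite ?qf ?mulr0.
Qed.

End PathMapLinear.

Section RelationMap.
Context (k : fieldType) (B B' : bound_quiver k) (F : qmap B B').
Hypothesis F_ideal : forall (x y : B) (f : kpath k x y),
  (kpath_map F f \in bq_ideal B' (F x) (F y)) = (f \in bq_ideal B x y).

(** Membership of the whole sum uses one direction of [F_ideal], minimality uses the other. *)
Lemma minimal_relation_map (x y : B) n (c : 'I_n -> k) (p : 'I_n -> qpath x y) :
  minimal_relation c p -> minimal_relation c (fun i => path_map F (p i)).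
Proof.
case=> n2 p2 sum_in sum_out; split=> // [i||J J0 J1].
- by rewrite /= size_map p2.
- by rewrite -kpath_map_sum F_ideal.
- by rewrite -kpath_map_sum F_ideal sum_out.
Qed.

Lemma compatible_on_map (H : groupType) (S : B' -> Prop) (f : arrow B' -> H) :
  compatible_on S f -> compatible_on (fun x => S (F x)) (f \o qmap_a F).
Proof.
move=> cf x y n c p Sx mr i j.
rewrite -!(walk_val_map F) !walk_map_of_path.
exact: (cf _ _ _ _ _ Sx (minimal_relation_map mr)).
Qed.

End RelationMap.

Section FullBoundSubquiver.
Context (k : fieldType) (B : bound_quiver k) (P : pred B).
Local Open Scope ring_scope.

Definition full_subquiver : quiver :=
  @Quiver {x : B | P x} {a : arrow B | P (src a) && P (tgt a)}
    (fun a => exist _ (src (val a)) (proj1 (andP (valP a))))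
    (fun a => exist _ (tgt (val a)) (proj2 (andP (valP a)))).

Definition subquiver_incl : qmap full_subquiver B :=
  @QMap full_subquiver B val val (fun=> erefl) (fun=> erefl).
Arguments subquiver_incl : simpl never.

Lemma subquiver_path_map_inj (x y : full_subquiver) :
  injective (@path_map _ _ subquiver_incl x y).
Proof.
move=> p q /(congr1 val) /= /(inj_map val_inj) pq; exact: val_inj.
Qed.

(** This presents the full subcategory on [P] once [P] is convex, since paths of [B] between
    vertices of [P] then stay in [P]. *)
Definition sub_ideal (x y : full_subquiver) : {pred kpath k x y} :=
  fun f => kpath_map subquiver_incl f
    \in bq_ideal B (subquiver_incl x) (subquiver_incl y).

Lemma sub_ideal_submod_closed (x y : full_subquiver) :
  submod_closed (@sub_ideal x y).
Proof.
exact: (@preim_submod_closed k _ _ (@kpath_map k _ _ subquiver_incl x y)).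
Qed.

HB.instance Definition _ (x y : full_subquiver) :=
  GRing.isSubmodClosed.Build k (kpath k x y) (@sub_ideal x y)
    (@sub_ideal_submod_closed x y).

End FullBoundSubquiver.

Section FullBoundSubquiverStructure.
Context (k : fieldType) (B : bound_quiver k) (P : pred B).
Local Notation SQ := (full_subquiver P).
Local Notation incl := (subquiver_incl P).
Local Open Scope ring_scope.

Lemma sub_idealE (x y : SQ) (f : kpath k x y) :
  (f \in @sub_ideal k B P x y) =
  (kpath_map incl f \in bq_ideal B (incl x) (incl y)).
Proof. by []. Qed.

Lemma sub_ideal_l (x y z : SQ) (f : kpath k x y) (g : kpath k y z) :
  f \in @sub_ideal k B P x y -> kpath_comp f g \in @sub_ideal k B P x z.
Proof. by rewrite !sub_idealE kpath_map_comp; apply: bq_ideal_l. Qed.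

Lemma sub_ideal_r (x y z : SQ) (f : kpath k x y) (g : kpath k y z) :
  g \in @sub_ideal k B P y z -> kpath_comp f g \in @sub_ideal k B P x z.
Proof. by rewrite !sub_idealE kpath_map_comp; apply: bq_ideal_r. Qed.

Lemma full_subquiver_locally_finite : locally_finite SQ.
Proof.
move=> x; have [s sP] := @bq_locally_finite k B (incl x).
exists (pmap insub s) => a xa; rewrite mem_pmap_sub.
by apply: sP; move: xa; rewrite -!(inj_eq val_inj).
Qed.

Lemma sub_ideal_length2 (x y : SQ) (f : kpath k x y) :
  f \in @sub_ideal k B P x y ->
  forall p : qpath x y, p \in msupp f -> (2 <= size (val p))%N.
Proof.
rewrite sub_idealE => fI p; rewrite -mcoeff_neq0.
rewrite -(mcoeff_kpath_map f p (@subquiver_path_map_inj _ _ P x y)) mcoeff_neq0.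
by move=> /(bq_length2 fI); rewrite /= size_map.
Qed.

Lemma sub_ideal_nilpotent (x : SQ) :
  exists n, forall (y z : SQ) (p : qpath y z),
  (y == x) || (z == x) -> (n <= size (val p))%N ->
  (<< p >> : kpath k y z) \in @sub_ideal k B P y z.
Proof.
have [n nP] := @bq_nilpotent k B (incl x); exists n => y z p yzx np.
by rewrite sub_idealE kpath_mapU nP ?size_map.
Qed.

Definition full_bound_subquiver : bound_quiver k :=
  @BoundQuiver k SQ (@sub_ideal k B P) sub_ideal_l sub_ideal_r
    full_subquiver_locally_finite sub_ideal_length2 sub_ideal_nilpotent.

Hypothesis convP : forall (x y : SQ) p, is_path (incl x) p (incl y) ->
  forall a, a \in p -> P (tgt a).

(** [pmap insub] discards every arrow with an end outside [P]; by convexity there is none, so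
    nothing is lost. *)
Fact lift_path_subproof (x y : SQ) (p : qpath (incl x) (incl y)) :
  is_path x (pmap insub (val p) : seq (arrow SQ)) y /\
  map val (pmap insub (val p) : seq (arrow SQ)) = val p.
Proof.
case: p => p xpy /=; have := convP xpy.
elim: p x xpy => [|a p IH] x /= xpy Pp.
  by split=> //; rewrite -(inj_eq val_inj).
case/andP: xpy => /eqP ax apy.
have Pta : P (tgt a) by apply: Pp; rewrite mem_head.
have Pa : P (src a) && P (tgt a) by rewrite ax (valP x).
have [b bp|b] := IH (exist _ (tgt a) Pta) apy.
  by apply: Pp; rewrite inE bp orbT.
move=> E; rewrite insubT /= E; split=> //.
apply/andP; split; first exact/eqP/val_inj.
by rewrite (_ : exist _ _ _ = exist _ (tgt a) Pta) //; apply: val_inj.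
Qed.

Definition lift_path (x y : SQ) (p : qpath (incl x) (incl y)) : qpath x y :=
  exist (fun s => is_path x s y) _ (proj1 (lift_path_subproof p)).

Lemma lift_pathK (x y : SQ) :
  cancel (@lift_path x y) (@path_map _ _ incl x y).
Proof. by move=> p; apply: val_inj => /=; case: (lift_path_subproof p). Qed.

Lemma path_mapK (x y : SQ) :
  cancel (@path_map _ _ incl x y) (@lift_path x y).
Proof. by move=> p; apply: subquiver_path_map_inj; rewrite lift_pathK. Qed.

Definition kpath_lift (x y : SQ) (f : kpath k (incl x) (incl y)) :
    kpath k x y :=
  mext (fun p => << lift_path p >> : kpath k x y) f.

HB.instance Definition _ (x y : SQ) :=
  GRing.Linear.copy (@kpath_lift x y)
    (mext (fun p : qpath (incl x) (incl y) => << lift_path p >> : kpath k x y)).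

Lemma kpath_liftK (x y : SQ) :
  cancel (@kpath_lift x y) (@kpath_map k _ _ incl x y).
Proof.
apply: (malg_lin_eq (u := @kpath_map k _ _ incl x y \o @kpath_lift x y)
  (v := idfun)) => p /=.
by rewrite /kpath_lift mextU kpath_mapU lift_pathK.
Qed.

Lemma kpath_mapK (x y : SQ) :
  cancel (@kpath_map k _ _ incl x y) (@kpath_lift x y).
Proof.
apply: (malg_lin_eq (u := @kpath_lift x y \o @kpath_map k _ _ incl x y)
  (v := idfun)) => p.
rewrite -[RHS]/(<< p >>) -[LHS]/(kpath_lift (kpath_map incl << p >>)).
by rewrite kpath_mapU /kpath_lift mextU path_mapK.
Qed.

Lemma kpath_lift_in (x y : SQ) (f : kpath k (incl x) (incl y)) :
  (kpath_lift f \in bq_ideal full_bound_subquiver x y) =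
  (f \in bq_ideal B (incl x) (incl y)).
Proof. by rewrite [LHS]sub_idealE kpath_liftK. Qed.

Local Notation SB := full_bound_subquiver.

Definition bqhom_lift (x y : SB) (q : bqhom (incl x) (incl y)) :
  bqhom x y := @bqpi k SB x y (kpath_lift (mrepr q)).

Lemma bqhom_liftE (x y : SB) (f : kpath k (incl x) (incl y)) :
  @bqhom_lift x y (bqpi f) = @bqpi k SB x y (kpath_lift f).
Proof.
apply/mclassP; rewrite -linearB kpath_lift_in.
by apply/mclassP; rewrite mreprK.
Qed.

Lemma bqhom_lift_is_linear (x y : SB) :
  linear (@bqhom_lift x y).
Proof.
move=> c q r; rewrite -[q]mreprK -[r]mreprK -!/(bqpi _) -linearP.
by rewrite !bqhom_liftE !linearP.
Qed.

HB.instance Definition _ (x y : SB) :=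
  GRing.isLinear.Build k _ _ *:%R (@bqhom_lift x y) (@bqhom_lift_is_linear x y).

Definition bqhom_incl (x y : SB) (q : bqhom x y) : bqhom (incl x) (incl y) :=
  @bqpi k B (incl x) (incl y) (@kpath_map k _ _ incl x y (mrepr q)).

Lemma bqhom_liftK (x y : SB) : cancel (@bqhom_lift x y) (@bqhom_incl x y).
Proof.
move=> q; rewrite -[RHS]mreprK; apply/mclassP.
rewrite -kpath_lift_in linearB /= kpath_mapK; apply/mclassP.
exact: mreprK.
Qed.

Lemma bqhom_inclK (x y : SB) : cancel (@bqhom_incl x y) (@bqhom_lift x y).
Proof. move=> q; rewrite bqhom_liftE kpath_mapK; exact: mreprK. Qed.

Lemma bqhom_lift_bij (x y : SB) : bijective (@bqhom_lift x y).
Proof. by exists (@bqhom_incl x y); [apply: bqhom_liftK|apply: bqhom_inclK]. Qed.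

Lemma bqhom_lift_comp (x y z : SB)
    (f : bqhom (incl x) (incl y)) (g : bqhom (incl y) (incl z)) :
  @bqhom_lift x z (bqcomp f g) = bqcomp (@bqhom_lift x y f) (@bqhom_lift y z g).
Proof.
rewrite -[f]mreprK -[g]mreprK -!/(bqpi _) bqcomp_pi !bqhom_liftE bqcomp_pi.
congr bqpi; apply: (can_inj (@kpath_mapK x z)).
by rewrite kpath_map_comp !kpath_liftK.
Qed.

Lemma bqhom_lift_id (x : SB) :
  @bqhom_lift x x (bqpi << path_nil (incl x) >>) =
  @bqpi k SB x x << path_nil x >>.
Proof.
rewrite bqhom_liftE /kpath_lift mextU; congr (bqpi << _ >>).
by apply: val_inj.
Qed.

End FullBoundSubquiverStructure.

Lemma lift_walk (k : fieldType) (B : bound_quiver k) (P : pred B)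
    (x y : full_subquiver P) w :
  is_walk (subquiver_incl P x) w (subquiver_incl P y) ->
  (forall l, l \in w -> P (src l.1) && P (tgt l.1)) ->
  exists2 w', is_walk x w' y & walk_map (subquiver_incl P) w' = w.
Proof.
elim: w x => [|[a b] w IH] x /= => [/eqP/val_inj-> _|/andP[/eqP ax aw] wP].
  by exists [::] => //=.
have Pa := wP _ (mem_head _ _).
pose a' : arrow (full_subquiver P) := exist _ a Pa.
have E : ltgt (a, b) = subquiver_incl P (ltgt (a', b)).
  by rewrite /ltgt; case: (b).
have [||w' w'_walk w'E] := IH (ltgt (a', b)); first by rewrite -E.
  by move=> l lw; apply: wP; rewrite inE lw orbT.
exists ((a', b) :: w'); last by rewrite /= w'E.
rewrite /= w'_walk andbT; apply/eqP/val_inj; apply: etrans ax.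
by rewrite /lsrc; case: (b).
Qed.

(** * Closed walks in a strongly simply connected category *)

Section FullSubcatPresentation.
Context (k : fieldType) (R : kcat k) (B : bound_quiver k).
Variables (phi : presentation R B) (S : {fset R}).
Hypothesis convS : convex phi S.

Definition obj_image : pred B :=
  fun v => v \in [fset (phi z : B) | z in S]%fset.

Local Notation SB := (full_bound_subquiver obj_image).
Local Notation incl := (subquiver_incl obj_image).

Lemma obj_image_convex (x y : SB) p :
  is_path (incl x) p (incl y) -> forall a, a \in p -> obj_image (tgt a).
Proof.
case: x y => _ /= /imfsetP[x xS ->] [_ /= /imfsetP[y yS ->]].
exact: convS.
Qed.

Definition subcat_obj (x : full_subcat S) : SB :=
  exist (fun v => obj_image v) (phi (val x)) (in_imfset _ phi (valP x)).

Lemma subcat_obj_bij : bijective subcat_obj.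
Proof.
have [g phiK gK] := kiso_obj_bij phi.
have gS (v : SB) : g (val v) \in S.
  by case: v => _ /= /imfsetP[z zS ->]; rewrite phiK.
exists (fun v : SB => [` gS v]%fset : full_subcat S) => [x|v].
  by apply: val_inj; rewrite /= phiK.
by apply: val_inj; rewrite /= gK.
Qed.

Definition subcat_hom (x y : full_subcat S) :
    {linear khom (full_subcat S) x y ->
            khom (bqcat SB) (subcat_obj x) (subcat_obj y)} :=
  (@bqhom_lift k B obj_image obj_image_convex (subcat_obj x) (subcat_obj y)
   \o @kiso_hom k R _ phi (val x) (val y) : {linear khom R (val x) (val y) -> _}).

Lemma subcat_hom_bij (x y : full_subcat S) : bijective (subcat_hom x y).
Proof.
exact: (bij_comp
  (@bqhom_lift_bij k B obj_image obj_image_convex (subcat_obj x) (subcat_obj y))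
  (kiso_hom_bij phi (val x) (val y))).
Qed.

Lemma subcat_hom_id (x : full_subcat S) :
  subcat_hom x x (kid _ x) = kid (bqcat SB) (subcat_obj x).
Proof.
rewrite /subcat_hom /= kiso_id.
exact: (@bqhom_lift_id k B obj_image obj_image_convex (subcat_obj x)).
Qed.

Lemma subcat_hom_comp (x y z : full_subcat S) (f : khom (full_subcat S) x y)
    (g : khom (full_subcat S) y z) :
  subcat_hom x z (kcomp f g) = kcomp (subcat_hom x y f) (subcat_hom y z g).
Proof.
rewrite /subcat_hom /= kiso_comp.
exact: (@bqhom_lift_comp k B obj_image obj_image_convex
  (subcat_obj x) (subcat_obj y) (subcat_obj z)).
Qed.

Definition full_subcat_presentation : presentation (full_subcat S) SB :=
  @KIso k (full_subcat S) (bqcat SB) subcat_obj subcat_hom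
    subcat_obj_bij subcat_hom_bij subcat_hom_id subcat_hom_comp.

End FullSubcatPresentation.

Section TotalSubcat.
Context (k : fieldType) (R : kcat k) (B : bound_quiver k).
Variables (phi : presentation R B) (S : {fset R}).
Hypothesis S_total : forall x, x \in S.

Lemma total_subcat_obj_bij : bijective (fun x : full_subcat S => phi (val x)).
Proof.
have [g phiK gK] := kiso_obj_bij phi.
exists (fun v => [` S_total (g v)]%fset : full_subcat S) => [x|v] /=.
  by apply: val_inj; rewrite /= phiK.
by rewrite gK.
Qed.

(** Simple connectedness speaks of presentations of convex full subcategories; the subcategory on
    all objects turns a presentation of [R] itself into one of these. *)
Definition total_subcat_presentation : presentation (full_subcat S) B :=
  @KIso k (full_subcat S) (bqcat B) (fun x => phi (val x))
    (fun x y => kiso_hom phi (val x) (val y)) total_subcat_obj_bij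
    (fun x y => kiso_hom_bij phi (val x) (val y))
    (fun x => kiso_id phi (val x))
    (fun x y z f g => kiso_comp phi f g).

Lemma total_convex : convex phi S.
Proof.
move=> x y _ _ p _ a _; have [g _ gK] := kiso_obj_bij phi.
by apply/imfsetP; exists (g (tgt a)) => //=; rewrite gK.
Qed.

End TotalSubcat.

Lemma ssc_trivial_pi1 (k : fieldType) (R : kcat k) (B : bound_quiver k)
    (phi : presentation R B) (S : {fset R}) :
  strongly_simply_connected phi -> convex phi S ->
  trivial_pi1 (full_bound_subquiver (obj_image phi S)).
Proof.
case=> _ _ _ sc convS; pose psi := full_subcat_presentation convS.
have [_ _ triv] := sc _ convS _ psi.
pose T : {fset full_subcat S} := seq_fset tt (fset_sub_enum S).
have T_total x : x \in T by rewrite seq_fsetE mem_fset_sub_enum.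
exact (triv T (total_convex (phi := psi) T_total) _
  (total_subcat_presentation psi T_total)).
Qed.

(* The convex hull of the vertices of [w] is finite, stays in [S], and its full
   bound subquiver has trivial fundamental group. *)
Lemma ssc_closed_walk_val (k : fieldType) (R : kcat k) (B : bound_quiver k)
    (phi : presentation R B) (H : groupType) (S : B -> Prop) (f : arrow B -> H)
    (x : B) w :
  strongly_simply_connected phi ->
  (forall a, S (src a) -> S (tgt a)) -> compatible_on S f ->
  is_walk x w x -> (forall l, l \in w -> S (src l.1)) ->
  walk_val f w = 1%g.
Proof.
move=> ssc S_succ cf xwx wS; have [_ _ fin _] := ssc.
have S_path u p v : is_path u p v -> S u -> S v.
  elim: p u => [|a p IH] u /= => [/eqP-> //|/andP[/eqP<- /IH]].
  by move=> + /S_succ; apply.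
have [g phiK gK] := kiso_obj_bij phi.
pose V : seq B := [seq src l.1 | l <- w] ++ [seq tgt l.1 | l <- w].
have VS v : v \in V -> S v.
  by rewrite mem_cat => /orP[] /mapP[l /wS Sl ->] //; apply: S_succ.
pose hull z := exists u v p q,
  [/\ u \in V, v \in V, is_path u p z & is_path z q v].
have V_hull v : v \in V -> hull v.
  by move=> Vv; exists v, v, [::], [::]; split=> //=.
have [ps psP] := choice (fun uv : B * B => fin uv.1 uv.2).
(* The finitely many paths between two vertices are listed by [ps]; [L] lists all vertices on paths
   between members of [V], so the hull is finite. *)
pose L : seq B := [seq z | u <- V, z <- flatten
  [seq u :: [seq tgt a | a <- p] | p <- flatten [seq ps (u, v) | v <- V]]].
have hullL z : hull z -> z \in L.
  case=> u [v [p [q [Vu Vv uz zv]]]]; apply/allpairsPdep.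
  exists u, z; split=> //; apply/flattenP.
  exists (u :: [seq tgt a | a <- p ++ q]).
    apply/mapP; exists (p ++ q) => //; apply/flattenP; exists (ps (u, v)).
      exact: map_f.
    exact: (psP (u, v) _ (is_path_cat uz zv)).
  have: z = last u [seq tgt a | a <- p].
    by elim: p u uz {Vu} => [|a p IH] u /= => [/eqP|/andP[_ /IH]].
  by rewrite map_cat => ->; rewrite -cat_cons mem_cat mem_last.
pose S0 : {fset R} := seq_fset tt [seq g z | z <- L & `[< hull z >]].
have S0P z : z \in S0 <-> hull (phi z).
  rewrite seq_fsetE; split=> [/mapP[v]|hz].
    by rewrite mem_filter => /andP[/asboolP hv _ ->]; rewrite gK.
  apply/mapP; exists (phi z); last by rewrite phiK.
  by rewrite mem_filter hullL // andbT; apply/asboolP.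
have imP (v : B) : obj_image phi S0 v <-> hull v.
  split=> [/imfsetP[z /S0P hz ->] //|hv].
  by apply/imfsetP; exists (g v); rewrite /= ?gK //; apply/S0P; rewrite gK.
have convS0 : convex phi S0.
  move=> a b /S0P[u [_ [p1 [_ [Vu _ ua _]]]]] /S0P[_ [v [_ [q2 [_ Vv _ bv]]]]].
  move=> p ab c cp; apply/imP; case/splitPr: cp ab => p2 q1 ab.
  have [d [ad /= /andP[/eqP cd db]]] := is_path_split ab.
  exists u, v, (p1 ++ rcons p2 c), (q1 ++ q2); split=> //.
    by apply: (is_path_cat ua); apply: is_path_rcons ad _ _.
  exact: is_path_cat db bv.
have wP l : l \in w -> obj_image phi S0 (src l.1) && obj_image phi S0 (tgt l.1).
  by move=> lw; apply/andP; split; apply/imP/V_hull; rewrite mem_cat;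
    apply/orP; [left|right]; apply/mapP; exists l.
(* The empty walk is set apart, because its hull is empty and does not contain [x]. *)
case Ew: w => [|l w0]; first by rewrite walk_val_nil.
have xP : obj_image phi S0 x.
  have := wP l; rewrite Ew mem_head => /(_ isT)/andP[]; move: xwx.
  by rewrite Ew /= => /andP[/eqP<- _]; case: (l) => a [].
pose B' := full_bound_subquiver (obj_image phi S0).
pose i : qmap B' B := subquiver_incl (obj_image phi S0).
pose x' : B' := exist _ x xP.
have [w' xw'x w'E] := @lift_walk _ _ _ x' x' w xwx wP.
(* Relations of [B'] start at hull vertices, which are reached by paths from vertices of [w] and so
   lie in [S]. *)
have cf' : compatible (f \o qmap_a i : arrow B' -> H).
  move=> u v n c p _; apply: (@compatible_on_map k B' B i _ H S f) => //.
  have [a [b [q [q' [/VS Sa _ auz _]]]]] : hull (i u) by apply/imP/(valP u).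
  exact: S_path auz Sa.
have /pi1_classP/= hom :
    pi1_class (exist _ w' xw'x : loop x') = pi1_class (loop_one x').
  by rewrite [LHS](ssc_trivial_pi1 ssc convS0) [RHS](ssc_trivial_pi1 ssc convS0).
rewrite -Ew -w'E walk_val_map.
by have := walk_val_homotopic cf' hom; rewrite walk_val_nil.
Qed.

(** * Lifting relations along a Galois covering *)

Section Covering.
Context (k : fieldType) (B' B : bound_quiver k) (F : qmap B' B).
Context (G : groupType) (act : G -> qmap B' B').
Hypothesis cov : galois_covering F act.
Local Open Scope ring_scope.

(** Fibres of [F] on vertices are orbits, so any arrow over [a] can be moved by [G] to start at
    [x]. *)
Lemma cover_arrow_lift (x : B') (a : arrow B) :
  src a = F x -> exists2 a', src a' = x & qmap_a F a' = a.
Proof.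
have [a0 <-] := gc_surj_a cov a; rewrite qmap_src.
case/(gc_fibre_v cov) => g ->; exists (qmap_a (act g) a0).
  by rewrite qmap_src.
exact: gc_inv_a cov _ _.
Qed.

(** Some element of [G] carries one arrow to the other; it fixes their common source, so it is the
    identity by freeness. *)
Lemma cover_arrow_inj (a b : arrow B') :
  src a = src b -> qmap_a F a = qmap_a F b -> a = b.
Proof.
move=> ab /(gc_fibre_a cov)[g bE]; move: ab; rewrite bE qmap_src => /esym gfix.
by rewrite (gc_free cov gfix) (gc_act1_a cov).
Qed.

Lemma cover_path_lift (x : B') (p : seq (arrow B)) (y : B) :
  is_path (F x) p y ->
  exists p' y', [/\ is_path x p' y', map (qmap_a F) p' = p & F y' = y].
Proof.
elim: p x => [|a p IH] x /= => [/eqP<-|/andP[/eqP/cover_arrow_lift[a' a'x <-]]].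
  by exists [::], x => /=.
rewrite qmap_tgt => /IH[p' [y' [p'P <- <-]]].
by exists (a' :: p'), y'; rewrite /= a'x eqxx.
Qed.

Lemma cover_path_inj (x y z : B') (p q : seq (arrow B')) :
  is_path x p y -> is_path x q z ->
  map (qmap_a F) p = map (qmap_a F) q -> p = q /\ y = z.
Proof.
elim: p x q => [|a p IH] x [|b q] //= => [/eqP<- /eqP //|].
move=> /andP[/eqP ax ap] /andP[/eqP bx bq] [ab pq].
have ba : b = a by apply: cover_arrow_inj; rewrite ?ab // ax bx.
by rewrite ba in bq *; have [-> ->] := IH _ _ ap bq pq.
Qed.

Lemma cover_path_map_inj (x y : B') : injective (@path_map _ _ F x y).
Proof.
move=> p q /(congr1 val) /= pq; apply: val_inj.
by have [] := cover_path_inj (valP p) (valP q) pq.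
Qed.

(** [gc_bound] gives one implication and [gc_lift] the other; coefficients are preserved because
    distinct parallel paths have distinct images. *)
Lemma cover_ideal (x y : B') (f : kpath k x y) :
  (kpath_map F f \in bq_ideal B (F x) (F y)) = (f \in bq_ideal B' x y).
Proof.
apply/idP/idP => [|/(gc_bound cov) //]; apply: (gc_lift cov) => p.
by rewrite mcoeff_kpath_map //; apply: cover_path_map_inj.
Qed.

(* The lifted paths are grouped by end point; each group is sent to a partial
   sum of the relation that lies in the ideal, so by minimality there is only
   one group. *)
Lemma cover_relation_lift (x : B') (y : B) n (c : 'I_n -> k)
    (p : 'I_n -> qpath (F x) y) :
  minimal_relation c p -> exists y' : B', forall i, exists2 q,
    is_path x q y' & map (qmap_a F) q = val (p i).
Proof.
case=> n2 _ sum_in sum_out.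
have [q qP] := choice (fun i => cover_path_lift (valP (p i))).
have {qP} [z qP] := choice qP.
have i0 : 'I_n := Ordinal (ltnW n2).
have [_ _ Fy] := qP i0; move: Fy p sum_in sum_out qP => <- p sum_in sum_out qP.
have q0P : is_path x (q i0) (z i0) by have [] := qP i0.
pose J : {set 'I_n} := [set i | z i == z i0].
pose r i : qpath x (z i0) := insubd (exist _ (q i0) q0P : qpath x (z i0)) (q i).
have rE i : i \in J -> val (r i) = q i.
  rewrite inE => /eqP zi; rewrite val_insubd.
  by have [+ _ _] := qP i; rewrite zi => ->.
have Fr i : i \in J -> path_map F (r i) = p i.
  by move=> iJ; apply: val_inj; rewrite /= rE //; have [] := qP i.
have sumJ : \sum_(i in J) c i *: (<< p i >> : kpath k (F x) (F (z i0)))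
    \in bq_ideal B (F x) (F (z i0)).
  rewrite (eq_bigr (fun i => c i *: (<< path_map F (r i) >> : kpath k _ _))).
    (* [gc_lift] keeps those terms of the whole relation that lift to paths from [x] to [z i0]; by
       uniqueness of lifts these have their indices in [J]. *)
    rewrite -kpath_map_sum cover_ideal; apply: (gc_lift cov) sum_in => s.
    rewrite !raddf_sum /= big_mkcond; apply: eq_bigr => i _.
    case: ifPn => iJ.
      rewrite -(Fr i iJ) !mcoeffZ !mcoeffU.
      by rewrite (inj_eq (@cover_path_map_inj _ _)).
    rewrite mcoeffZ mcoeffU; case: eqP => [ps|_]; last by rewrite mulr0.
    case/negP: iJ; rewrite inE; apply/eqP; have [xq qp _] := qP i.
    by have [] := cover_path_inj xq (valP s); rewrite // qp ps.
  by move=> i iJ; rewrite Fr.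
have {}sum_out := sum_out J; exists (z i0) => i.
have [JT|JT] := eqVneq J setT.
  have iJ : i \in J by rewrite JT inE.
  by exists (q i); [rewrite -(rE _ iJ) (valP (r i))|have [] := qP i].
suff : \sum_(i in J) c i *: (<< p i >> : kpath k (F x) (F (z i0)))
    \notin bq_ideal B (F x) (F (z i0)) by rewrite sumJ.
apply: sum_out; last by rewrite properT.
by apply/set0Pn; exists i0; rewrite inE.
Qed.

End Covering.

(** * Chains of minimal relations and their lifts *)

Section LinkedArrows.
Context (k : fieldType) (B : bound_quiver k).

(* [linked a b w]: a chain of minimal relations makes [b] homotopic to the
   walk [a w], with [w] a walk that avoids the common source of [a], [b]. *)
Inductive linked (a : arrow B) : arrow B -> seq (letter B) -> Prop :=
| linked_refl : linked a a [::]
| linked_step b b' w u v x y n (c : 'I_n -> k) (p : 'I_n -> qpath x y) i j :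
    linked a b w -> minimal_relation c p ->
    val (p i) = b :: u -> val (p j) = b' :: v ->
    linked a b' (w ++ walk_of_path u ++ walk_inv (walk_of_path v)).

Lemma linked_src a b w : linked a b w -> src a = src b.
Proof.
elim=> // {b w} b b' w u v x y n c p i j _ -> _ pi pj.
have /andP[/eqP-> _] : is_path x (b :: u) y by rewrite -pi (valP (p i)).
by have /andP[/eqP-> _] : is_path x (b' :: v) y by rewrite -pj (valP (p j)).
Qed.

Lemma linked_trans a b c w w' :
  linked a b w -> linked b c w' -> linked a c (w ++ w').
Proof.
move=> ab; elim=> [|{c w'} c c' w' u v x y n d p i j _ IH mr pi pj].
  by rewrite cats0.
by rewrite catA; apply: linked_step IH mr pi pj.
Qed.

Lemma linked_sym a b w : linked a b w -> exists w', linked b a w'.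
Proof.
elim=> [|{b w} b b' w u v x y n d p i j _ [w' ba] mr pi pj].
  by exists [::]; apply: linked_refl.
by eexists; apply: linked_trans ba; apply: linked_step (linked_refl _) mr pj pi.
Qed.

(** The walk of a chain is made of tails of paths leaving the common source, and each tail starts at
    the target of an arrow from that source. *)
Lemma linked_sub (S : B -> Prop) a b w :
  (forall c, S (src c) -> S (tgt c)) ->
  (forall c, src c = src a -> S (tgt c)) ->
  linked a b w -> forall l, l \in w -> S (src l.1).
Proof.
move=> S_succ Sa; elim=> // {b w} b b' w u v x y n c p i j ab IH _ pi pj l.
have sab := linked_src ab.
have path_S s z q t : S z -> is_path z q t -> s \in q -> S (src s).
  elim: q z => //= e q IHq z Sz /andP[/eqP ez eq]; rewrite inE => /orP[/eqP->|].
    by rewrite ez.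
  by apply: IHq eq; apply: S_succ; rewrite ez.
have /andP[/eqP bx bu] : is_path x (b :: u) y by rewrite -pi (valP (p i)).
have /andP[/eqP b'x b'v] : is_path x (b' :: v) y by rewrite -pj (valP (p j)).
rewrite !mem_cat => /or3P[/IH //|/mapP[e eu ->]|].
  by apply: path_S bu eu; apply: Sa.
rewrite mem_rev -map_comp => /mapP[e ev ->].
by apply: path_S b'v ev; apply: Sa; rewrite sab bx.
Qed.

End LinkedArrows.

Section LinkedLift.
Context (k : fieldType) (B' B : bound_quiver k) (F : qmap B' B).
Context (G : groupType) (act : G -> qmap B' B').
Hypothesis cov : galois_covering F act.

(** Each relation of the chain lifts to paths from [src a'] with a common end point; uniqueness of
    lifts glues the lifted steps together. *)
Lemma linked_lift a b w (a' : arrow B') : linked a b w -> qmap_a F a' = a ->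
  exists b' w', [/\ qmap_a F b' = b, src b' = src a',
    is_walk (tgt a') w' (tgt b') & walk_map F w' = w].
Proof.
move=> ab Fa'; elim: ab => [|{b w} b c w u v x y n d p i j _].
  by exists a', [::]; rewrite /= eqxx.
case=> b' [w' [Fb' b'a' w'P <-]] mr pi pj.
have xE : x = F (src b').
  have /andP[/eqP<- _] : is_path x (b :: u) y by rewrite -pi (valP (p i)).
  by rewrite -Fb' qmap_src.
subst x; have [y' yP] := cover_relation_lift cov mr.
have [q + qE] := yP i; rewrite {}pi in qE; case: q qE => // b1 u' [b1E u'E].
move=> /= /andP[/eqP b1src u'P].
have b1b' : b1 = b' by apply: (cover_arrow_inj cov); rewrite // Fb'.
have [r + rE] := yP j; rewrite {}pj in rE; case: r rE => // c' v' [c'E v'E].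
move=> /= /andP[/eqP c'src v'P].
exists c', (w' ++ walk_of_path u' ++ walk_inv (walk_of_path v')); split=> //.
- by rewrite c'src.
- apply: (is_walk_cat w'P); rewrite -b1b'.
  apply: (@is_walk_cat _ _ y'); first by rewrite is_walk_of_path.
  by apply: is_walk_inv; rewrite is_walk_of_path.
- rewrite /walk_map !map_cat -!/(walk_map _ _) walk_map_inv !walk_map_of_path.
  by rewrite u'E v'E.
Qed.

Context (R : kcat k) (phi : presentation R B').
Hypothesis ssc : strongly_simply_connected phi.

(** Both chains lift from the same [a'] and end at the unique arrow over [b] leaving [src a']. One
    lifted walk followed by the inverse of the other is then closed, so its value is trivial. *)
Lemma linked_walk_val (H : groupType) (S : B -> Prop) (f : arrow B -> H)
    a b u v :
  (forall c, S (src c) -> S (tgt c)) -> compatible_on S f ->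
  (forall c, src c = src a -> S (tgt c)) ->
  linked a b u -> linked a b v -> walk_val f u = walk_val f v.
Proof.
move=> S_succ cf Sa abu abv; have [a' Fa'] := gc_surj_a cov a.
have [b1 [u' [Fb1 b1a' u'P uE]]] := linked_lift abu Fa'.
have [b2 [v' [Fb2 b2a' v'P vE]]] := linked_lift abv Fa'.
have b12 : b2 = b1.
  by apply: (cover_arrow_inj cov); [rewrite b1a' b2a'|rewrite Fb1 Fb2].
rewrite {}b12 in v'P.
have cf' := compatible_on_map (cover_ideal cov) cf.
have := ssc_closed_walk_val ssc _ cf' (is_walk_cat u'P (is_walk_inv v'P)) _.
rewrite walk_val_cat walk_val_inv -!walk_val_map uE vE => val1.
apply/eqP; rewrite -[walk_val f v]invgK -mulg_eq1; apply/eqP; apply: val1.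
  by move=> c; rewrite -qmap_src -qmap_tgt; apply: S_succ.
move=> l; rewrite mem_cat -qmap_src => /orP[lu|].
  apply: (linked_sub S_succ Sa abu (l := (qmap_a F l.1, l.2))).
  by rewrite -uE; apply: map_f.
rewrite /walk_inv mem_rev => /mapP[m mv ->].
apply: (linked_sub S_succ Sa abv (l := (qmap_a F m.1, m.2))).
by rewrite -vE; apply: map_f.
Qed.

End LinkedLift.

(** * Extension of labellings *)

Section Height.
Variable Q : quiver.

(** The bound is strict, so the trivial path excludes [height_lt 0] at every vertex and the
    inductions on [n] have vacuous base cases. *)
Definition height_lt n (x : Q) : Prop :=
  forall p y, is_path x p y -> (size p < n)%N.

Lemma height_lt_tgt n (a : arrow Q) :
  height_lt n.+1 (src a) -> height_lt n (tgt a).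
Proof.
by move=> ha p y ap; apply: (ha (a :: p) y); rewrite /= eqxx.
Qed.

Lemma height_lt_succ n (a : arrow Q) :
  height_lt n (src a) -> height_lt n (tgt a).
Proof.
by move=> ha; apply: height_lt_tgt => p y /ha /leq_trans; apply.
Qed.

Lemma height_lt_path n (x y : Q) p : height_lt n x -> is_path x p y ->
  forall a, a \in p -> height_lt n (src a).
Proof.
elim: p x => //= a p IH x hx /andP[/eqP ax ap] b; rewrite inE => /orP[/eqP->|].
  by rewrite ax.
by apply: IH ap b; apply: height_lt_succ; rewrite ax.
Qed.

(** Without oriented cycles a path meets no vertex twice, and [m] arrows meet [m + 1] vertices;
    hence the strict bound. *)
Lemma acyclic_height_lt (s : seq Q) :
  acyclic Q -> (forall x, x \in s) -> forall x, height_lt (size s) x.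
Proof.
move=> acQ sP x p y xy; rewrite -(size_map (@tgt Q)).
apply: (uniq_leq_size (s1 := x :: map (@tgt Q) p)) => [|z _]; last exact: sP.
elim: p x xy => // a p IH x xy; rewrite cons_uniq.
apply/andP; split; last first.
  by apply: IH; case/andP: xy.
apply/negP => /mapP[c cp xE].
case/splitPr: cp xy => p1 p2 /is_path_split[z [xz /= /andP[/eqP cz _]]].
have /acQ/(congr1 size) := is_path_rcons xz cz (esym xE).
by rewrite size_rcons.
Qed.

End Height.

Section LabellingExtension.
Context (k : fieldType) (B' B : bound_quiver k) (F : qmap B' B).
Context (G : groupType) (act : G -> qmap B' B').
Hypothesis cov : galois_covering F act.
Context (R : kcat k) (phi : presentation R B').
Hypothesis ssc : strongly_simply_connected phi.
Variable N : nat.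
Hypothesis heightN : forall x : B, height_lt N x.
Local Open Scope group_scope.

(** The arrows with [link_rep a = a] will be the basis: one arrow in each class of linked arrows. *)
Definition link_rep (a : arrow B) : arrow B :=
  choose (fun b => `[< exists w, linked b a w >]) a.

Lemma link_repP a : exists w, linked (link_rep a) a w.
Proof.
have aa : `[< exists w, linked a a w >].
  by apply/asboolP; exists [::]; apply: linked_refl.
exact/asboolP/(chooseP (P := fun b => `[< exists w, linked b a w >]) aa).
Qed.

Lemma eq_link_rep a b w : linked a b w -> link_rep a = link_rep b.
Proof.
move=> ab; have [w' ba] := linked_sym ab.
have E : (fun c => `[< exists u, linked c a u >]) =1
         (fun c => `[< exists u, linked c b u >]).
  move=> c; apply/asboolP/asboolP => -[u cu].
    by eexists; apply: linked_trans cu ab.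
  by eexists; apply: linked_trans cu ba.
rewrite /link_rep (eq_choose E); apply: choose_id; apply/asboolP.
  by exists w.
by exists [::]; apply: linked_refl.
Qed.

(** A relation with paths [b u] and [b' v] forces the label of [b'] to be that of [b u] divided by
    that of [v]; a chain composes such equations. *)
Lemma linked_val (H : groupType) (S : B -> Prop) (f : arrow B -> H) a b w :
  compatible_on S f -> S (src a) -> linked a b w -> f b = f a * walk_val f w.
Proof.
move=> cf Sa; elim=> [|{b w} b b' w u v x y n c p i j ab IH mr pi pj].
  by rewrite walk_val_nil mulg1.
have bx : src b = x.
  by have /andP[/eqP] : is_path x (b :: u) y by rewrite -pi (valP (p i)).
rewrite (linked_src ab) bx in Sa; have := cf _ _ _ _ _ Sa mr i j.
rewrite pi pj !walk_val_cons /letter_val /= => bu.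
by rewrite !walk_val_cat walk_val_inv !mulgA -IH bu mulgK.
Qed.

(** Induction on height: a label is that of the representative times the value of a walk whose
    arrows start at vertices of smaller height. *)
Lemma labelling_unique (H : groupType) (f g : arrow B -> H) :
  compatible f -> compatible g ->
  (forall a, link_rep a = a -> f a = g a) -> f =1 g.
Proof.
move=> cf cg fg a.
suff: forall n a, height_lt n (src a) -> f a = g a by apply; apply: heightN.
elim=> [b hb|n IH {}a ha]; first by have := hb [::] (src b) (eqxx _).
have [w aw] := link_repP a.
rewrite (linked_val cf _ aw) // (linked_val cg _ aw) //; congr (_ * _).
  have [u ru] := link_repP (link_rep a).
  by apply: fg; apply: eq_link_rep aw.
apply: eq_walk_val => l /(linked_sub (@height_lt_succ B n) _ aw) hl.
apply/IH/hl => c; rewrite (linked_src aw) => ca.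
by apply: height_lt_tgt; rewrite ca.
Qed.

(* The arrows of the class of [a] receive the value forced by a chain of
   relations from its representative; two chains give the same value because
   they lift to a closed walk of the covering that avoids the source of [a]. *)
Lemma labelling_extension_on (H : groupType) (f0 : arrow B -> H) n :
  exists f, compatible_on (height_lt n) f /\
    forall a, height_lt n (src a) -> link_rep a = a -> f a = f0 a.
Proof.
have [wit witP] := choice link_repP.
elim: n => [|n [f [cf fE]]].
  exists f0; split=> // x y n c p h0; by have := h0 [::] x (eqxx _).
have same_val a u v : height_lt n.+1 (src a) ->
    linked (link_rep a) a u -> linked (link_rep a) a v ->
    walk_val f u = walk_val f v.
  move=> ha ru rv.
  apply: (linked_walk_val cov ssc (@height_lt_succ B n) cf _ ru rv).
  by move=> c; rewrite (linked_src ru) => ca; apply: height_lt_tgt; rewrite ca.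
(* When the source satisfies [height_lt n.+1], the walk [wit a] only uses arrows on which [f] is
   already known to be compatible. *)
pose g a := if `[< height_lt n (src a) >] then f a
  else f0 (link_rep a) * walk_val f (wit a).
have g_path x y p : height_lt n x -> is_path x p y ->
    walk_val g (walk_of_path p) = walk_val f (walk_of_path p).
  move=> hx xy; apply: eq_walk_val => _ /mapP[a ap ->] /=.
  by rewrite /g asboolT //; apply: height_lt_path xy _ ap.
exists g; split=> [x y m c p hx mr i j|a ha ra]; last first.
  rewrite /g; case: asboolP => [han|_]; first exact: fE.
  have aa : linked (link_rep a) a [::] by rewrite ra; apply: linked_refl.
  by rewrite (same_val a _ _ ha (witP a) aa) walk_val_nil mulg1 ra.
have [hxn|hxn] := pselect (height_lt n x).
  by rewrite !(g_path x y) ?(valP (p _)) //; apply: cf mr i j.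
have [_ p2 _ _] := mr.
case pi: (val (p i)) (p2 i) (valP (p i)) => [//|b u] _ xbu.
case pj: (val (p j)) (p2 j) (valP (p j)) => [//|b' v] _ /= /andP[/eqP b'x b'v].
have /andP[/eqP bx bu] := xbu.
have hb : height_lt n (tgt b) by apply: height_lt_tgt; rewrite bx.
have hb' : height_lt n (tgt b') by apply: height_lt_tgt; rewrite b'x.
rewrite !walk_val_cons (g_path _ _ _ hb bu) (g_path _ _ _ hb' b'v).
rewrite /letter_val /= /g bx b'x asboolF //.
have bb' := linked_step (linked_refl b) mr pi pj.
(* The chosen chain to [b], prolonged by the relation, is a second chain from the same
   representative to [b']; by [same_val] it may replace [wit b']. *)
have bw := linked_step (witP b) mr pi pj; rewrite (eq_link_rep bb') in bw *.
rewrite (same_val b' _ _ _ (witP b') bw) ?b'x //.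
by rewrite !walk_val_cat walk_val_inv !mulgA mulgVK.
Qed.

Lemma labelling_extension (H : groupType) (f0 : arrow B -> H) :
  exists2 f, compatible f & forall a, link_rep a = a -> f a = f0 a.
Proof.
have [f [cf fE]] := labelling_extension_on f0 N.
exists f => [|a]; last exact: fE.
by move=> x y n c p _; apply: cf.
Qed.

End LabellingExtension.

(** * Free fundamental groups *)

Section SpanningTree.
Context (Q : quiver) (X : arrow Q -> Prop) (x : Q).
Hypothesis X_conn : forall y, exists w,
  is_walk x w y /\ forall l, l \in w -> X l.1.

Fact walk_length_ex y : exists n,
  `[< exists w, [/\ is_walk x w y, forall l, l \in w -> X l.1 & size w = n] >].
Proof.
by have [w [xy wX]] := X_conn y; exists (size w); apply/asboolP; exists w.
Qed.

Definition root_dist y : nat := ex_minn (walk_length_ex y).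

(** The parent edge is the last letter of a shortest walk from [x]; dropping it leaves a shorter
    walk. *)
Lemma tree_parent_ex y : exists ol : option (letter Q),
  if ol is Some l then
    [/\ ltgt l = y, X l.1, y <> x & (root_dist (lsrc l) < root_dist y)%N]
  else y = x.
Proof.
have [->|yx] := eqVneq y x; first by exists None.
rewrite /root_dist; case: (ex_minnP (walk_length_ex y)) => n.
move=> /asboolP[w [xy wX <-]] _ {n}; case/lastP: w xy wX => [|w l] xy wX.
  by move: yx; rewrite eq_sym (xy : x == y).
exists (Some l).
have [z [xz /= /andP[/eqP lz /eqP ly]]] :
    exists z, is_walk x w z /\ is_walk z [:: l] y.
  elim: w x xy {wX yx} => [|m w IH] u /=; first by exists u; rewrite eqxx.
  case/andP=> mu /IH[z [mz zl]]; exists z; by rewrite mu.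
split=> //; first by apply: wX; rewrite mem_rcons mem_head.
  exact/eqP.
case: ex_minnP => m _ mmin; rewrite size_rcons ltnS; apply: mmin.
apply/asboolP; exists w; split=> //; first by rewrite lz.
by move=> m' m'w; apply: wX; rewrite mem_rcons inE m'w orbT.
Qed.

(** [T] collects the parent edges and [t] follows them from the root. The last clause is what will
    make the loop defined by a tree arrow trivial. *)
Lemma spanning_tree : exists (T : arrow Q -> Prop) (t : Q -> seq (letter Q)),
  [/\ forall a, T a -> X a, t x = [::],
      forall y, is_walk x (t y) y /\ forall l, l \in t y -> T l.1 &
      forall a, T a -> t (tgt a) = rcons (t (src a)) (a, true) \/
                       t (src a) = rcons (t (tgt a)) (a, false)].
Proof.
have [par parP] := choice tree_parent_ex.
pose T a := exists y b, par y = Some (a, b).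
(* [n] is fuel; any amount at least [root_dist y] yields the same walk. *)
pose tw := fix tw (n : nat) (y : Q) {struct n} : seq (letter Q) :=
  if n isn't m.+1 then [::] else
  if par y is Some l then rcons (tw m (lsrc l)) l else [::].
have twE n m y :
    (root_dist y <= n)%N -> (root_dist y <= m)%N -> tw n y = tw m y.
  elim: n m y => [|n IH] [|m] y //=; have := parP y; case: (par y) => [l|//].
  - by case=> _ _ _ lt; rewrite leqn0 => /eqP E; rewrite E in lt.
  - by case=> _ _ _ lt _; rewrite leqn0 => /eqP E; rewrite E in lt.
  - case=> _ _ _ lt yn ym; congr rcons; apply: IH; rewrite -ltnS.
      exact: leq_trans lt yn.
    exact: leq_trans lt ym.
pose t y := tw (root_dist y) y.
have tS y l : par y = Some l -> t y = rcons (t (lsrc l)) l.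
  move=> yl; have := parP y; rewrite yl => -[_ _ _ lt].
  rewrite /t -(twE (root_dist y).+1) //= yl; congr rcons.
  by apply: twE => //; apply: ltnW.
have t0 y : par y = None -> t y = [::].
  by rewrite /t; case: root_dist => //= n ->.
exists T, t; split.
- by move=> a [y [b yab]]; have := parP y; rewrite yab => -[].
- by apply: t0; have := parP x; case: (par x) => // l [].
- move=> y; have [n] := ubnP (root_dist y); elim: n y => // n IH y yn.
  have := parP y; case E: (par y) => [l|]; last first.
    by move=> yx; rewrite (t0 _ E) /= yx eqxx.
  case=> ly _ _ lt; rewrite (tS _ _ E).
  have [|xl lT] := IH (lsrc l); first exact: leq_trans lt yn.
  split=> [|m].
    by rewrite -cats1; apply: (is_walk_cat xl); rewrite /= ly !eqxx.
  rewrite mem_rcons inE => /orP[/eqP->|/lT //].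
  by exists y, l.2; rewrite -surjective_pairing.
- move=> a [y [b yab]]; have := parP y; rewrite yab => -[ay _ _ _].
  have := tS _ _ yab; rewrite -ay /ltgt /lsrc /=.
  by case: b {yab ay}; [left|right].
Qed.

End SpanningTree.

(** * From a free groupoid to a free vertex group *)

Section FundamentalGroupFree.
Context (k : fieldType) (B : bound_quiver k) (X : arrow B -> Prop) (x : B).
Hypothesis X_unique : forall (H : groupType) (f g : arrow B -> H),
  compatible f -> compatible g -> (forall a, X a -> f a = g a) -> f =1 g.
Hypothesis X_extend : forall (H : groupType) (f : arrow B -> H),
  exists2 g, compatible g & forall a, X a -> g a = f a.
Hypothesis B_conn : forall P : B -> Prop, P x ->
  (forall a, P (src a) <-> P (tgt a)) -> forall y, P y.
Local Open Scope group_scope.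

(* If the vertices joined to [x] through [X] were not closed under arrows, the
   coboundary of their indicator function would be a nontrivial compatible
   labelling that is trivial on [X]. *)
Lemma basis_connected y : exists w,
  is_walk x w y /\ forall l, l \in w -> X l.1.
Proof.
move: y; apply: B_conn => [|a]; first by exists [::]; rewrite /= eqxx.
pose P y := exists w, is_walk x w y /\ forall l, l \in w -> X l.1.
have PX l : X l.1 -> P (lsrc l) -> P (ltgt l).
  move=> Xl [w [xw wX]]; exists (rcons w l); split.
    by rewrite -cats1; apply: (is_walk_cat xw); rewrite /= !eqxx.
  by move=> m; rewrite mem_rcons inE => /orP[/eqP->|/wX].
(* [h] is the indicator function, with values in a group of order two. *)
pose s : {perm bool} := tperm true false.
pose h y : {perm bool} := if `[< P y >] then 1 else s.
have s1 : s <> 1.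
  by move=> /(congr1 (fun t : {perm bool} => t true)); rewrite tpermL perm1.
have := X_unique (@compatible_potential k B _ h)
  (@compatible_potential k B _ (fun=> 1)) _ a.
rewrite mulg1 invg1 => E.
have {E} : (h (src a))^-1 * h (tgt a) = 1.
  apply: E => b Xb; have bP : P (src b) <-> P (tgt b).
    by split; [apply: (PX (b, true))|apply: (PX (b, false))].
  by rewrite /h (asbool_equiv_eq bP) mulVg.
move/mulg1_eq; rewrite invgK /h -!/(P _) => ha.
by split=> Pa; move: ha; rewrite (asboolT Pa); case: asboolP => // _ /esym.
Qed.

Section Rerooting.
Variable t : B -> seq (letter B).
Hypothesis t_root : t x = [::].
Hypothesis t_walk : forall y, is_walk x (t y) y.

Local Notation walks u v := {w : seq (letter B) | is_walk u w v}.

Definition as_walk u v w (uwv : is_walk u w v) : walks u v :=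
  exist (fun s => is_walk u s v) w uwv.

Fact reroot_subproof u v (w : walks u v) :
  is_walk x (t u ++ val w ++ walk_inv (t v)) x.
Proof.
apply: (is_walk_cat (t_walk u)); apply: (is_walk_cat (valP w)).
exact: is_walk_inv (t_walk v).
Qed.

(** Closing walks up by means of [t] retracts the fundamental groupoid onto its vertex group at
    [x]. *)
Definition reroot u v (w : walks u v) : pi1 x :=
  pi1_class (exist (fun s => is_walk x s x) _ (reroot_subproof w)).

Lemma eq_reroot u v (w w' : walks u v) :
  homotopic u v (val w) (val w') -> reroot w = reroot w'.
Proof.
move=> ww'; apply/pi1_classP => /=.
exact: homotopic_cat (t_walk u) (is_walk_inv (t_walk v)) ww'.
Qed.

Lemma reroot_cat u v z (w1 : walks u v) (w2 : walks v z) (w : walks u z) :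
  val w = val w1 ++ val w2 -> reroot w = reroot w1 * reroot w2.
Proof.
move=> wE; rewrite -[RHS]/(pi1_mul _ _) pi1_mulE; apply/pi1_classP.
rewrite /= wE; apply: homotopic_sym.
have := @homotopic_cat k B x v v x (t u ++ val w1) (val w2 ++ walk_inv (t z))
  (walk_inv (t v) ++ t v) [::].
rewrite -!catA /=; apply; last exact: homotopic_invl (t_walk v).
  exact: is_walk_cat (t_walk u) (valP w1).
exact: is_walk_cat (valP w2) (is_walk_inv (t_walk z)).
Qed.

Lemma reroot_loop (c : pi1 x) : reroot (pi1_repr c : walks x x) = c.
Proof.
rewrite -[RHS]pi1_reprK; congr pi1_class; apply: val_inj.
by rewrite /= t_root cats0.
Qed.

Lemma reroot_nil u (w : walks u u) : val w = [::] -> reroot w = 1.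
Proof.
move=> w0; apply/pi1_classP => /=; rewrite w0 /=.
exact: homotopic_invr (t_walk u).
Qed.

Definition arrow_walk (a : arrow B) : walks (src a) (tgt a) :=
  @as_walk _ _ [:: (a, true)] (introT andP (conj (eqxx _) (eqxx _))).

Lemma morph1 (H : groupType) (psi : pi1 x -> H) :
  {morph psi : a b / a * b} -> psi 1 = 1.
Proof. by move=> psiM; apply: (mulgI (psi 1)); rewrite -psiM !mulg1. Qed.

(** As [reroot] is multiplicative and respects formal inverses, a homomorphism on the vertex group
    is encoded by a labelling of the arrows. *)
Lemma morph_reroot (H : groupType) (psi : pi1 x -> H) u v (w : walks u v) :
  {morph psi : a b / a * b} ->
  psi (reroot w) = walk_val (fun a => psi (reroot (arrow_walk a))) (val w).
Proof.
move=> psiM; case: w => w /= uwv; elim: w u uwv => [|[a b] w IH] u uwv.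
  have uv := eqP uwv; move: uv uwv => /= <- uwv.
  by rewrite walk_val_nil reroot_nil // morph1.
have /andP[/eqP au av] := uwv; subst u.
have ab : is_walk (lsrc (a, b)) [:: (a, b)] (ltgt (a, b)) by rewrite /= !eqxx.
rewrite (@reroot_cat _ _ _ (as_walk ab) (as_walk av)) // psiM IH walk_val_cons.
congr (_ * _); rewrite /letter_val; case: b {uwv av} ab => ab /=.
  by congr psi; apply: eq_reroot; apply: homotopic_refl.
apply/eqP; rewrite -mulg_eq1 -psiM.
rewrite -(@reroot_cat _ _ _ _ _
  (as_walk (is_walk_cat ab (valP (arrow_walk a))))) //.
rewrite -(morph1 psiM).
rewrite -(@reroot_nil (tgt a) (@as_walk _ _ [::] (eqxx (tgt a)))) //.
apply/eqP; congr psi; apply: eq_reroot; apply: homotopic_inv_arrow.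
Qed.

Lemma compatible_reroot (H : groupType) (psi : pi1 x -> H) :
  {morph psi : a b / a * b} ->
  compatible (fun a => psi (reroot (arrow_walk a))).
Proof.
move=> psiM y z n c p _ mr i j.
have wP l : is_walk y (walk_of_path (val (p l))) z.
  by rewrite is_walk_of_path (valP (p l)).
have E l := morph_reroot (as_walk (wP l)) psiM.
rewrite -(E i) -(E j); congr psi; apply: eq_reroot.
exact: homotopic_relation mr.
Qed.

Lemma reroot_tree a :
  t (tgt a) = rcons (t (src a)) (a, true) \/
  t (src a) = rcons (t (tgt a)) (a, false) -> reroot (arrow_walk a) = 1.
Proof.
move=> ta; apply/pi1_classP => /=; rewrite -cat1s catA.
apply: homotopic_trans (homotopic_invr (t_walk (tgt a))).
apply: homotopic_catr (is_walk_inv (t_walk _)) _.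
case: ta => E; rewrite E -cats1.
  by apply: homotopic_refl; rewrite cats1 -E.
rewrite -catA /= -[X in homotopic _ _ _ X]cats0.
exact: homotopic_catl (t_walk _) (homotopic_inv_arrow a).
Qed.

End Rerooting.

Lemma free_pi1 : free_group (pi1 x).
Proof.
have [T [t [TX t_root tP tT]]] := spanning_tree basis_connected.
have t_walk y : is_walk x (t y) y by have [] := tP y.
have t_val (H : groupType) (f : arrow B -> H) y :
    (forall a, T a -> f a = 1) -> walk_val f (t y) = 1.
  move=> fT; have [_ tyT] := tP y.
  rewrite (@eq_walk_val _ _ f (fun=> 1)); last by move=> l /tyT/fT.
  rewrite /walk_val big1 // => -[a b] _; rewrite /letter_val /=.
  by case: b => //; rewrite invg1.
exists {a : arrow B | X a /\ ~ T a}.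
exists (fun e => reroot t_walk (arrow_walk (sval e))).
move=> H f.
(* Tree arrows receive 1, as their rerooted loops are trivial. *)
pose f0 a := if pselect (X a /\ ~ T a) is left h then f (exist _ a h) else 1.
have f0T a : T a -> f0 a = 1.
  by move=> Ta; rewrite /f0; case: pselect => // h; case: (proj2 h).
have f0E e : f0 (sval e) = f e.
  case: e => a h; rewrite /f0 /=; case: pselect => [h'|/(_ h) //].
  by congr (f (exist _ a _)); apply: Prop_irrelevance.
have [g cg gE] := X_extend f0.
have gT a : T a -> g a = 1 by move=> Ta; rewrite gE ?f0T //; apply: TX.
pose phi (c : pi1 x) := walk_val g (val (pi1_repr c)).
have phiE u : phi (pi1_class u) = walk_val g (val u).
  exact: walk_val_homotopic cg (pi1_repr_class u).
exists phi; split=> [c d|e|psi psiM psi_e c].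
- rewrite -[c in LHS]pi1_reprK -[d in LHS]pi1_reprK -[_ * _]/(pi1_mul _ _).
  by rewrite pi1_mulE phiE walk_val_cat.
- rewrite phiE /= -cat1s !walk_val_cat walk_val_inv !(t_val _ g) //.
  rewrite invg1 mulg1 mul1g.
  rewrite walk_val_cons walk_val_nil mulg1 /letter_val /= -f0E gE //.
  by case: (svalP e).
(* Uniqueness: the labelling induced by [psi] is compatible and agrees with [g] on [X], both being 1
   on the tree and prescribed by [f] off it. *)
- rewrite -{1}[c](reroot_loop t_root t_walk) (morph_reroot _ _ psiM).
  apply: eq_walk_val => l _; move: {l}l.1.
  apply: X_unique (compatible_reroot t_walk psiM) cg _ => a Xa.
  have [Ta|nTa] := pselect (T a).
    by rewrite gT // (reroot_tree _ (tT _ Ta)) (morph1 psiM).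
  by rewrite gE //; have := psi_e (exist _ a (conj Xa nTa)); rewrite -f0E.
Qed.

End FundamentalGroupFree.

(** A nonzero morphism has a representative with nonempty support, which supplies a path of the
    quiver; thus connectedness of [A] passes to the quiver. *)
Lemma presentation_connected (k : fieldType) (A : kcat k) (B : bound_quiver k)
    (phi : presentation A B) (P : B -> Prop) (x : B) :
  connected_kcat A -> P x -> (forall a, P (src a) <-> P (tgt a)) ->
  forall y, P y.
Proof.
move=> [_ conn] Px PE y; apply: contrapT => nPy.
have [g phiK gK] := kiso_obj_bij phi.
have P_path u v p : is_path u p v -> P u <-> P v.
  by elim: p u => [|a p IH] u /= => [/eqP->|/andP[/eqP<- /IH <-]].
have hom_P (u v : A) (f : khom A u v) : f != 0%R -> P (phi u) <-> P (phi v).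
  have [h homK _] := kiso_hom_bij phi u v => f0.
  have : kiso_hom phi u v f != 0%R.
    apply: contraNneq f0 => f0; apply/eqP/(can_inj homK).
    by rewrite f0 linear0.
  rewrite -[kiso_hom _ _ _ _]mreprK; set q := mrepr _ => q0.
  have [p _] : exists p : qpath (phi u : B) (phi v : B), p \in msupp q.
    apply: contrapT => nq; case/eqP: q0; rewrite (_ : q = 0%R) ?linear0 //.
    apply/malgP => p; rewrite mcoeff0 mcoeff_outdom //.
    by apply/negP => pq; apply: nq; exists p.
  exact: P_path (valP p).
case: (conn (fun a => `[< P (phi a) >])).
- by exists (g x); apply/asboolP; rewrite gK.
- by exists (g y); apply/asboolP; rewrite gK.
move=> u [v [/asboolP Pu /asboolP nPv [[f /hom_P uv]|[f /hom_P vu]]]].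
  by apply/nPv/uv.
by apply/nPv/vu.
Qed.

Theorem theoremA (k : closedFieldType) (A : kcat k)
  (lbA : locally_bounded A) (finA : finitely_many_objects A)
  (connA : connected_kcat A)
  (BA : bound_quiver k) (phiA : presentation A BA) (triA : acyclic BA)
  (At : kcat k) (Bt : bound_quiver k) (phit : presentation At Bt)
  (F : qmap Bt BA) (G : groupType) (act : G -> qmap Bt Bt)
  (covF : galois_covering F act)
  (sscAt : strongly_simply_connected phit)
  (x : BA) :
  free_group (pi1 x).
Proof.
have [s sA] := finA; have [g phiK gK] := kiso_obj_bij phiA.
pose vs : seq BA := [seq phiA a | a <- s].
have heightN : forall y : BA, height_lt (size vs) y.
  apply: acyclic_height_lt triA _ => y.
  by apply/mapP; exists (g y); rewrite ?gK.
apply: (@free_pi1 _ _ (fun a => link_rep a = a)) => [H f1 f2|H f|P Px PE].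
- exact: labelling_unique heightN _ f1 f2.
- exact: (labelling_extension covF sscAt heightN f).
- exact: (presentation_connected phiA connA Px PE).
Qed.
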